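(* Let $R$ be a (Noetherian) Cohen-Macaulay local ring whose residue field has characteristic $0$. Let $I$ be an equimultiple ideal of $R$ with $h=\operatorname{ht}(I)\ge1$, let $J$ be a minimal reduction of $I$, and let $r$ be the reduction number of $I$ with respect to $J$. Then $$\operatorname{core}(I)=J^{r+1}:I^r.$$
   Context: An ideal $J\subseteq I$ is a reduction of $I$ if $JI^n=I^{n+1}$ for some integer $n$; the least such $n\ge 0$ is the reduction number of $I$ with respect to $J$. A minimal reduction is a reduction minimal with respect to inclusion. $\operatorname{core}(I)$ is the intersection of all reductions of $I$. The ideal $I$ is equimultiple if the minimal reductions of $I$ are generated by $h$ elements, where $h=\operatorname{ht}(I)$. *)

(* Defs.v *)
From mathcomp Require Import all_boot all_order all_algebra.
From mathcomp Require Import boolp classical_sets.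

Set Implicit Arguments.
Unset Strict Implicit.
Unset Printing Implicit Defensive.
Import GRing.Theory.

Local Open Scope classical_set_scope.
Local Open Scope ring_scope.

(* Ideals are classical sets and the unit ideal is allowed; the predicate      *)
(* [idealr_closed] of ring_quotient is boolean and restricted to proper ideals. *)
Definition is_ideal (R : comNzRingType) (A : set R) : Prop :=
  [/\ A 0, (forall x y, A x -> A y -> A (x + y))
    & (forall a x, A x -> A (a * x))].

Definition ideal_gen (R : comNzRingType) (G : set R) : set R :=
  smallest (@is_ideal R) G.

Definition ideal_mul (R : comNzRingType) (A B : set R) : set R :=
  ideal_gen [set x | exists a b, [/\ A a, B b & x = a * b]].

Definition ideal_pow (R : comNzRingType) (A : set R) (n : nat) : set R :=
  iter n (ideal_mul A) setT.

Definition ideal_colon (R : comNzRingType) (A B : set R) : set R :=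
  [set x | forall b, B b -> A (x * b)].

Definition is_prime (R : comNzRingType) (P : set R) : Prop :=
  [/\ is_ideal P, ~ P 1 & forall x y, P (x * y) -> P x \/ P y].

Definition is_maximal (R : comNzRingType) (m : set R) : Prop :=
  [/\ is_ideal m, ~ m 1
    & forall A, is_ideal A -> ~ A 1 -> m `<=` A -> A = m].

Definition is_local (R : comNzRingType) (m : set R) : Prop :=
  is_maximal m /\ forall m', is_maximal m' -> m' = m.

Definition noetherian (R : comNzRingType) : Prop :=
  forall A : set R, is_ideal A -> exists s : seq R, A = ideal_gen [set` s].

(* A chain [P 0 < ... < P n] of primes, of length n; values of P beyond n are   *)
(* irrelevant.                                                                  *)
Definition prime_chain (R : comNzRingType) (n : nat) (P : nat -> set R) : Prop :=
  (forall i, (i <= n)%N -> is_prime (P i)) /\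
  (forall i, (i < n)%N -> P i `<` P i.+1).

(* Dimension, heights and depth are relations with their value in nat; an       *)
(* infinite value is related to no n.                                           *)
Definition krull_dim (R : comNzRingType) (d : nat) : Prop :=
  (exists P : nat -> set R, prime_chain d P) /\
  (forall n (P : nat -> set R), prime_chain n P -> (n <= d)%N).

Definition prime_height (R : comNzRingType) (Q : set R) (h : nat) : Prop :=
  (exists P, prime_chain h P /\ P h = Q) /\
  (forall n P, prime_chain n P -> P n = Q -> (n <= h)%N).

Definition ideal_height (R : comNzRingType) (A : set R) (h : nat) : Prop :=
  (exists Q, [/\ is_prime Q, A `<=` Q & prime_height Q h]) /\
  (forall Q n, is_prime Q -> A `<=` Q -> prime_height Q n -> (h <= n)%N).

(* Each s_i is a nonzerodivisor modulo (s_0, ..., s_(i-1)), and (s) <> R.       *)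
Definition regular_seq (R : comNzRingType) (s : seq R) : Prop :=
  (forall i x, (i < size s)%N ->
     ideal_gen [set` take i s] (s`_i * x) -> ideal_gen [set` take i s] x) /\
  ~ ideal_gen [set` s] 1.

Definition depth (R : comNzRingType) (m : set R) (d : nat) : Prop :=
  (exists s : seq R, [/\ [set` s] `<=` m, regular_seq s & size s = d]) /\
  (forall s : seq R, [set` s] `<=` m -> regular_seq s -> (size s <= d)%N).

Definition cohen_macaulay_local (R : comNzRingType) (m : set R) : Prop :=
  [/\ noetherian R, is_local m & exists d, krull_dim R d /\ depth m d].

(* The residue field R/m, presented as a surjective morphism with kernel m.     *)
Definition is_residue_field (R : comNzRingType) (m : set R)
    (k : fieldType) (pi : {rmorphism R -> k}) : Prop :=
  (forall y, exists x, pi x = y) /\ (forall x, pi x = 0 <-> m x).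

Definition is_reduction (R : comNzRingType) (I J : set R) : Prop :=
  [/\ is_ideal J, J `<=` I
    & exists n, ideal_mul J (ideal_pow I n) = ideal_pow I n.+1].

Definition reduction_number (R : comNzRingType) (I J : set R) (r : nat) : Prop :=
  ideal_mul J (ideal_pow I r) = ideal_pow I r.+1 /\
  (forall n, ideal_mul J (ideal_pow I n) = ideal_pow I n.+1 -> (r <= n)%N).

Definition is_minimal_reduction (R : comNzRingType) (I J : set R) : Prop :=
  is_reduction I J /\ (forall K, is_reduction I K -> K `<=` J -> K = J).

Definition core (R : comNzRingType) (I : set R) : set R :=
  \bigcap_(K in [set K | is_reduction I K]) K.

Definition equimultiple (R : comNzRingType) (I : set R) : Prop :=
  exists h, ideal_height I h /\
    forall K, is_minimal_reduction I K ->
      exists s : h.-tuple R, K = ideal_gen [set` s].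

(* Main.v *)
Require Import Defs.
From mathcomp Require Import all_boot all_order all_algebra.
From mathcomp Require Import boolp classical_sets.
From mathcomp Require Import ring zify.

(** Write J = (a_1, ..., a_h). The generators of a reduction of I with h generators, and all
    powers of these generators, form a regular sequence in any order: depth equals
    dimension, so the ideal they generate, having height h, contains a regular sequence of
    length h ([grade_height]), and then so do its h generators ([regular_of_grade]).
    Therefore J^(n+1) is the intersection of the ideals (a_1^(n_1+1), ..., a_h^(n_h+1)) with
    n_1 + ... + n_h = n ([pow_cap]). This reduces both inclusions to statements about a
    single generator, modulo powers of the others, where I behaves like an ideal with a
    principal reduction.

    For the inclusion of J^(r+1) : I^r in the core, an element x of the colon ideal satisfies
    x I^n <= (a_i^(n_i+1))_i for all exponents with sum n, which is the set [joint_colon]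
    ([colon_joint]). If one generator a is exchanged for another generator b of a
    reduction, the set does not change ([joint_colon_exchange]): modulo the powers of the
    common generators a and b are regular and generate reductions of I, so that the claim
    is the independence of the principal reduction in the description a (R : S) of the core
    in dimension one, S being the blowup. Being a reduction is an open condition
    ([eventually_reduces]), so any two reductions are joined by a chain of such exchanges
    through a generic point of the line between them ([joint_colon_indep]). Hence x lies in
    every minimal reduction, and every reduction contains a minimal one
    ([minimal_reduction_ex]).

    For the other inclusion let x be in the core and b in I. Then x lies in
    (a_1 + t_1 b, ..., a_h + t_h b) for general integers t_i. Intersecting over t_h, then
    over t_(h-1), and so on, replaces a_i + t_i b by a_i^(n_i+1) at the price of a factor
    b^(n_i): if y lies in (a + t b) for as many integers t as the degree of
    an integrality equation of b over (a), then y b^n lies in (a^(n+1)) ([mul_pow_mem]).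
    So x b^n is in all the ideals (a_i^(n_i+1))_i with sum n ([core_mul_pow]), hence in
    J^(n+1). For n = r this gives x I^r <= J^(r+1), because in characteristic 0 the r-th
    powers of the elements of I generate I^r ([pow_subset_powers]). *)

Set Implicit Arguments.
Unset Strict Implicit.
Unset Printing Implicit Defensive.
Import GRing.Theory.

Local Open Scope classical_set_scope.
Local Open Scope ring_scope.

(** * Calculus of ideals *)

Section Ideals.
Variable R : comNzRingType.
Implicit Types (A B C I J L N P Q Z m : set R) (a b c u v w x y z : R).
Implicit Types (s t : seq R).

Lemma ideal0 A : is_ideal A -> A 0. Proof. by case. Qed.

Lemma idealD A x y : is_ideal A -> A x -> A y -> A (x + y).
Proof. by case=> _ + _; apply. Qed.

Lemma ideal_mull A a x : is_ideal A -> A x -> A (a * x).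
Proof. by case=> _ _; apply. Qed.

Lemma ideal_mulr A a x : is_ideal A -> A x -> A (x * a).
Proof. by rewrite mulrC; apply: ideal_mull. Qed.

Lemma idealN A x : is_ideal A -> A x -> A (- x).
Proof. by rewrite -mulN1r; apply: ideal_mull. Qed.

Lemma idealB A x y : is_ideal A -> A x -> A y -> A (x - y).
Proof. by move=> iA Ax Ay; apply: idealD => //; apply: idealN. Qed.

Lemma ideal_cong A x y : is_ideal A -> A (x - y) -> A y -> A x.
Proof. by move=> iA Axy Ay; rewrite -(subrK y x); apply: idealD. Qed.

Lemma ideal_congC A x y : is_ideal A -> A (x - y) -> A (y - x).
Proof. by move=> iA; rewrite -opprB; move/(idealN iA); rewrite opprK. Qed.

Lemma ideal_sum A (T : Type) (r : seq T) (p : pred T) (F : T -> R) :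
  is_ideal A -> (forall i, p i -> A (F i)) -> A (\sum_(i <- r | p i) F i).
Proof.
move=> iA AF; apply: big_ind => //; first exact: ideal0.
by move=> x y; apply: idealD.
Qed.

Lemma ideal_gen_ideal (G : set R) : is_ideal (ideal_gen G).
Proof.
split=> [B [iB _]|x y Gx Gy B BG|a x Gx B BG]; first exact: ideal0.
  by apply: idealD; [case: BG|exact: Gx|exact: Gy].
by apply: ideal_mull; [case: BG|exact: Gx].
Qed.

Lemma sub_ideal_gen (G : set R) : G `<=` ideal_gen G.
Proof. exact: sub_gen_smallest. Qed.

Lemma ideal_gen_min (G : set R) A : is_ideal A -> G `<=` A -> ideal_gen G `<=` A.
Proof. exact: smallest_sub. Qed.

Lemma ideal_set0 : is_ideal [set (0 : R)].
Proof.
split=> //= [x y -> ->|a x ->]; first by rewrite addr0.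
by rewrite mulr0.
Qed.

Lemma ideal_setT : is_ideal [set: R]. Proof. by []. Qed.

Lemma ideal_preim A w : is_ideal A -> is_ideal [set c | A (c * w)].
Proof.
move=> iA; split=> /= [|x y|a x]; first by rewrite mul0r; apply: ideal0.
  by rewrite mulrDl; apply: idealD.
by rewrite -mulrA; apply: ideal_mull.
Qed.

(** [ideal_adj A x] is the ideal A + (x) and [ideal_span A s] the ideal A + (s):
    carrying the base ideal A along replaces passing to the quotient by A. *)
Definition ideal_adj A x : set R := [set z | exists c, A (z - c * x)].

Definition ideal_span A s : set R := foldr (fun x B => ideal_adj B x) A s.

Definition ideal_add A B : set R := [set z | exists2 b, B b & A (z - b)].

Lemma adj_ideal A x : is_ideal A -> is_ideal (ideal_adj A x).
Proof.
move=> iA; split=> [|y z [c Ac] [d Ad]|a y [c Ac]].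
- by exists 0; rewrite mul0r subr0; apply: ideal0.
- by exists (c + d); have := idealD iA Ac Ad; congr (A _); ring.
- by exists (a * c); have := ideal_mull a iA Ac; congr (A _); ring.
Qed.

Lemma sub_adj A x : A `<=` ideal_adj A x.
Proof. by move=> z Az; exists 0; rewrite mul0r subr0. Qed.

Lemma mem_adj A x : is_ideal A -> ideal_adj A x x.
Proof. by move=> iA; exists 1; rewrite mul1r subrr; apply: ideal0. Qed.

Lemma adj_min A B x : is_ideal B -> A `<=` B -> B x -> ideal_adj A x `<=` B.
Proof.
move=> iB AB Bx z [c /AB]; move/(ideal_cong iB); apply.
exact: ideal_mull.
Qed.

Lemma adj_mono A B x : A `<=` B -> ideal_adj A x `<=` ideal_adj B x.
Proof. by move=> AB z [c /AB]; exists c. Qed.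

Lemma adjC A x y : ideal_adj (ideal_adj A x) y = ideal_adj (ideal_adj A y) x.
Proof.
by apply/seteqP; split=> z [c [d Acd]]; exists d; exists c; congr (A _): Acd; ring.
Qed.

Lemma adj_cong A x y : is_ideal A -> A (x - y) -> ideal_adj A x = ideal_adj A y.
Proof.
move=> iA Axy; apply/seteqP; split; apply: adj_min;
  do ?[exact: adj_ideal|exact: sub_adj].
  by exists 1; rewrite mul1r.
by exists 1; rewrite mul1r; apply: ideal_congC.
Qed.

Lemma span_ideal A s : is_ideal A -> is_ideal (ideal_span A s).
Proof. by move=> iA; elim: s => //= x s; apply: adj_ideal. Qed.

Lemma sub_span A s : A `<=` ideal_span A s.
Proof. by elim: s => //= x s IH z /IH; apply: sub_adj. Qed.

Lemma mem_span A s x : is_ideal A -> x \in s -> ideal_span A s x.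
Proof.
move=> iA; elim: s => //= y s IH; rewrite inE => /orP[/eqP->|/IH].
  by apply: mem_adj; apply: span_ideal.
exact: sub_adj.
Qed.

Lemma span_min A B s :
  is_ideal B -> A `<=` B -> (forall x, x \in s -> B x) -> ideal_span A s `<=` B.
Proof.
move=> iB AB; elim: s => //= x s IH sB; apply: adj_min => //.
  by apply: IH => y ys; apply: sB; rewrite inE ys orbT.
by apply: sB; rewrite mem_head.
Qed.

Lemma span_adj A s x : ideal_span (ideal_adj A x) s = ideal_adj (ideal_span A s) x.
Proof. by elim: s => //= y s ->; apply: adjC. Qed.

Lemma span_mono A B s : A `<=` B -> ideal_span A s `<=` ideal_span B s.
Proof. by elim: s => //= x s IH /IH; apply: adj_mono. Qed.

Lemma span_subset A s t :
  is_ideal A -> {subset s <= t} -> ideal_span A s `<=` ideal_span A t.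
Proof.
move=> iA st; apply: span_min; [exact: span_ideal|exact: sub_span|].
by move=> x /st; apply: mem_span.
Qed.

Lemma eq_span_mem A s t : is_ideal A -> s =i t -> ideal_span A s = ideal_span A t.
Proof.
by move=> iA st; apply/seteqP; split; apply: span_subset => // x; rewrite st.
Qed.

Lemma ideal_gen_seq s : ideal_gen [set` s] = ideal_span [set 0] s.
Proof.
apply/seteqP; split.
  apply: ideal_gen_min; first by apply: span_ideal; apply: ideal_set0.
  by move=> x /=; apply: mem_span; apply: ideal_set0.
apply: span_min; first exact: ideal_gen_ideal.
  by move=> x ->; apply: ideal0; apply: ideal_gen_ideal.
by move=> x xs; apply: sub_ideal_gen.
Qed.

Lemma add_ideal A B : is_ideal A -> is_ideal B -> is_ideal (ideal_add A B).
Proof.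
move=> iA iB; split=> [|y z [c Bc Ac] [d Bd Ad]|a y [c Bc Ac]].
- by exists 0; [exact: ideal0|rewrite subr0; apply: ideal0].
- by exists (c + d); [exact: idealD|have := idealD iA Ac Ad; congr (A _); ring].
- by exists (a * c); [exact: ideal_mull|have := ideal_mull a iA Ac; congr (A _); ring].
Qed.

Lemma add_min A B C : is_ideal C -> A `<=` C -> B `<=` C -> ideal_add A B `<=` C.
Proof. by move=> iC AC BC x [b /BC Cb /AC]; move/(ideal_cong iC); apply. Qed.

(** * Products and powers *)

Lemma mul_ideal A B : is_ideal (ideal_mul A B).
Proof. exact: ideal_gen_ideal. Qed.

Lemma mem_mul A B a b : A a -> B b -> ideal_mul A B (a * b).
Proof. by move=> Aa Bb; apply: sub_ideal_gen; exists a, b. Qed.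

Lemma mul_min A B C : is_ideal C -> (forall a b, A a -> B b -> C (a * b)) ->
  ideal_mul A B `<=` C.
Proof.
by move=> iC ABC; apply: ideal_gen_min => // _ [a [b [Aa Bb ->]]]; apply: ABC.
Qed.

Lemma mul_mono A A' B B' : A `<=` A' -> B `<=` B' ->
  ideal_mul A B `<=` ideal_mul A' B'.
Proof.
move=> AA' BB'; apply: mul_min; first exact: mul_ideal.
by move=> a b /AA' Aa /BB' Bb; apply: mem_mul.
Qed.

Lemma mul_subl A B : is_ideal A -> ideal_mul A B `<=` A.
Proof. by move=> iA; apply: mul_min => // a b Aa _; apply: ideal_mulr. Qed.

Lemma pow_ideal A n : is_ideal (ideal_pow A n).
Proof. by case: n => [|n]; [exact: ideal_setT|exact: mul_ideal]. Qed.

Lemma powM A p q x y : ideal_pow A p x -> ideal_pow A q y ->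
  ideal_pow A (p + q) (x * y).
Proof.
move=> + Ay; move: x; elim: p => [|p IH] x.
  by move=> _; apply: ideal_mull => //; apply: pow_ideal.
move: x; apply: (mul_min (ideal_preim y (pow_ideal A (p.+1 + q)))).
by move=> a b Aa Ab; rewrite /= -mulrA; apply: mem_mul => //; apply: IH.
Qed.

(** Inclusions out of A^(p+q) can thus be checked on products, although A^(p+q) is
    defined by p + q successive multiplications by A. *)
Lemma powD_min A p q C : is_ideal C ->
  (forall x y, ideal_pow A p x -> ideal_pow A q y -> C (x * y)) ->
  ideal_pow A (p + q) `<=` C.
Proof.
move=> iC; elim: p C iC => [|p IH] C iC ABC.
  by move=> x Ax; rewrite -(mul1r x); apply: ABC.
apply: mul_min => // a b Aa; rewrite mulrC; move: b.
apply: (IH [set z | C (z * a)]); first exact: ideal_preim.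
move=> x y Ax Ay /=; rewrite mulrC mulrA; apply: ABC => //.
exact: mem_mul.
Qed.

Lemma pow_mono A B n : A `<=` B -> ideal_pow A n `<=` ideal_pow B n.
Proof. by move=> AB; elim: n => // n IH; apply: mul_mono. Qed.

Lemma pow_decr A n p : (p <= n)%N -> ideal_pow A n `<=` ideal_pow A p.
Proof.
move/subnK <-; apply: powD_min; first exact: pow_ideal.
by move=> x y _ Ay; apply: ideal_mull => //; apply: pow_ideal.
Qed.

Lemma mem_pow A n a : A a -> ideal_pow A n (a ^+ n).
Proof. by move=> Aa; elim: n => // n IH; rewrite exprS; apply: mem_mul. Qed.

Lemma pow1 A : is_ideal A -> ideal_pow A 1 = A.
Proof.
move=> iA; apply/seteqP; split; first exact: mul_subl.
by move=> x Ax; rewrite -(mulr1 x); apply: mem_mul.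
Qed.

(** Multiplying the inclusion I^(n+1) <= K I^n by powers of I. *)
Lemma reduction_ge K I n p : is_ideal I -> (n <= p)%N ->
  ideal_pow I n.+1 `<=` ideal_mul K (ideal_pow I n) ->
  ideal_pow I p.+1 `<=` ideal_mul K (ideal_pow I p).
Proof.
move=> iI /subnKC <- KI; rewrite -addSn; apply: powD_min; first exact: mul_ideal.
move=> x y /KI Kx Iy; move: x Kx.
apply: (mul_min (ideal_preim y (mul_ideal _ _))) => a b Ka Ib /=.
by rewrite -mulrA; apply: mem_mul => //; apply: powM.
Qed.

End Ideals.

(** * Noetherian induction and associated primes *)

Section Eventually.

(** Genericity is measured along the natural numbers: their differences are
    units when the residue field has characteristic 0, so that a property which
    fails for finitely many values of a parameter holds for all large integers. *)
Definition eventually (p : nat -> Prop) := exists T, forall t, (T <= t)%N -> p t.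

Lemma eventually_and p q :
  eventually p -> eventually q -> eventually (fun t => p t /\ q t).
Proof.
move=> [T pT] [U qU]; exists (maxn T U) => t; rewrite geq_max => /andP[Tt Ut].
by split; [apply: pT|apply: qU].
Qed.

Lemma eventually_all (X : eqType) (s : seq X) (p : X -> nat -> Prop) :
  (forall x, x \in s -> eventually (p x)) ->
  eventually (fun t => forall x, x \in s -> p x t).
Proof.
elim: s => [|x s IH] ps; first by exists 0%N.
have ps' y : y \in s -> eventually (p y) by move=> ys; apply: ps; rewrite inE ys orbT.
have [T pT] := eventually_and (ps x (mem_head _ _)) (IH ps').
by exists T => t /pT[px ps''] y; rewrite inE => /orP[/eqP->|/ps''].
Qed.

End Eventually.

Section Noetherian.
Variables (R : comNzRingType) (nR : noetherian R).
Implicit Types (A B C I J L N P Q Z : set R) (a b c u v w x y z : R).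
Implicit Types (s : seq R) (t : nat).

Lemma noetherian_ind (p : set R -> Prop) :
  (forall A, is_ideal A -> (forall B, is_ideal B -> A `<` B -> p B) -> p A) ->
  forall A, is_ideal A -> p A.
Proof.
move=> step A0 iA0; apply: contrapT => np0.
pose S := {A : set R | is_ideal A /\ ~ p A}.
have next (A : S) : exists B : S, sval A `<` sval B.
  case: A => A [iA nA] /=; apply: contrapT => nB; apply: nA; apply: step => // B iB AB.
  by apply: contrapT => npB; apply: nB; exists (exist _ B (conj iB npB)).
have [f fP] := choice next.
pose c n := sval (iter n f (exist _ A0 (conj iA0 np0))).
have ic n : is_ideal (c n) by rewrite /c; case: (iter _ _ _) => B [].
have cS n : c n `<` c n.+1 by apply: fP.
have cmono n q : (n <= q)%N -> c n `<=` c q.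
  move/subnK<-; elim: (q - n)%N => // d IH x /IH.
  by case: (cS (d + n)%N) => + _; apply.
pose U : set R := [set x | exists n, c n x].
have iU : is_ideal U.
  split=> [|x y [n cx] [q cy]|a x [n cx]].
  - by exists 0%N; apply: ideal0.
  - exists (n + q)%N; apply: idealD => //.
      by apply: cmono cx; rewrite leq_addr.
    by apply: cmono cy; rewrite leq_addl.
  - by exists n; apply: ideal_mull.
have [s Us] := nR iU.
have [N sN] : eventually (fun t => forall x, x \in s -> c t x).
  apply: eventually_all => x xs.
  have [n cx] : U x by rewrite Us; apply: sub_ideal_gen.
  by exists n => t nt; apply: cmono cx.
have UN : U `<=` c N by rewrite Us; apply: ideal_gen_min => // x /sN; apply.
by case: (cS N) => _; apply; move=> x cx; apply: UN; exists N.+1.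
Qed.

(** The ascending chain of the ideals A + (v_0, ..., v_(n-1)) is stationary. *)
Lemma noetherian_seq A (v : nat -> R) : is_ideal A ->
  exists K, ideal_span A (mkseq v K) (v K).
Proof.
move=> iA.
pose U : set R := ideal_gen (A `|` range v).
have [s Us] : exists s, U = ideal_gen [set` s] by apply/nR/ideal_gen_ideal.
have mono n q : (n <= q)%N -> ideal_span A (mkseq v n) `<=` ideal_span A (mkseq v q).
  move=> nq; apply: span_subset => // x /mapP[i]; rewrite mem_iota => ni ->.
  by apply: map_f; rewrite mem_iota; lia.
pose W : set R := [set x | exists n, ideal_span A (mkseq v n) x].
have iW : is_ideal W.
  split=> [|x y [n cx] [q cy]|a x [n cx]].
  - by exists 0%N; apply: ideal0.
  - exists (n + q)%N; apply: idealD => //; first exact: span_ideal.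
      by apply: mono cx; rewrite leq_addr.
    by apply: mono cy; rewrite leq_addl.
  - by exists n; apply: ideal_mull => //; apply: span_ideal.
have UW : U `<=` W.
  apply: ideal_gen_min => // x [Ax|[i _ <-]]; first by exists 0%N.
  exists i.+1; apply: mem_span => //; apply: map_f; rewrite mem_iota; lia.
have [K sK] : eventually (fun t => forall x, x \in s -> ideal_span A (mkseq v t) x).
  apply: eventually_all => x xs.
  have [n cx] : W x by apply: UW; rewrite Us; apply: sub_ideal_gen.
  by exists n => t nt; apply: mono cx.
exists K; have : U (v K) by apply: sub_ideal_gen; right; exists K.
rewrite Us; move: (v K); apply: ideal_gen_min; first exact: span_ideal.
by move=> x xs; apply: sK.
Qed.

Definition nonzerodivisor A x := forall y, A (x * y) -> A y.

Definition associated A P :=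
  is_prime P /\ exists2 w, ~ A w & P = [set c | A (c * w)].

(** A proper annihilator A : w that is not prime grows: if it contains c d but neither c
    nor d, then A : (d w) is proper too and contains c. *)
Lemma associated_ex A w : is_ideal A -> ~ A w ->
  exists2 P, associated A P & forall c, A (c * w) -> P c.
Proof.
move=> iA; have := ideal_preim w iA; move E: [set c | A (c * w)] => B iB.
move: B iB w E; apply: noetherian_ind => B iB IH w E nAw.
have [pB|npB] := pselect (is_prime B).
  by exists B; [split=> //; exists w|rewrite -E].
have [c [d [Bcd nc nd]]] : exists c d, [/\ B (c * d), ~ B c & ~ B d].
  apply: contrapT => H; apply: npB; split=> // [|x y Bxy].
    by rewrite -E /= mul1r.
  by apply: contrapT => /not_orP[nx ny]; apply: H; exists x, y.
have [||||P aP AP] := IH [set e | A (e * (d * w))] _ _ (d * w).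
- exact: ideal_preim.
- split=> [x|]; rewrite -E /=; first by rewrite mulrCA => /(ideal_mull d iA).
  move/(_ c); rewrite /= mulrA -/([set c | A (c * w)] (c * d)) E => /(_ Bcd).
  by rewrite -E in nc.
- by [].
- by move=> Adw; apply: nd; rewrite -E.
- by exists P => // x Ax; apply: AP; rewrite mulrCA; apply: ideal_mull.
Qed.

(** Noetherian induction from A to A + (w), where A : w is prime: a prime associated to A
    is A : w or is associated to A + (w). *)
Lemma associated_finite A : is_ideal A ->
  exists Ps : seq (set R), forall P, associated A P -> P \in Ps.
Proof.
move: A; apply: noetherian_ind => A iA IH.
have [A1|nA1] := pselect (A 1).
  by exists [::] => P [_ [w []]]; rewrite -(mulr1 w); apply: ideal_mull.
have [P0 [pP0 [w nAw EP0]] _] := associated_ex iA nA1.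
have [||Ps PsP] := IH (ideal_adj A w); first exact: adj_ideal.
  split; first exact: sub_adj.
  by move/(_ w (mem_adj w iA)).
exists (P0 :: Ps) => P [pP [z nAz EP]]; rewrite inE.
have [[d [Bdz nAdz]]|nB] := pselect (exists d, ideal_adj A w (d * z) /\ ~ A (d * z)).
  (* A multiple of z in A + (w), outside A, has annihilator both P and P0. *)
  apply/orP; left; apply/eqP.
  have [c Ac] := Bdz.
  have EPs x : P x <-> A (x * (d * z)).
    rewrite EP /=; split=> [/(ideal_mull d iA)|]; first by rewrite mulrCA.
    rewrite mulrA => Axdz; have /= : P (x * d) by rewrite EP.
    case: pP => _ _ /[apply]; rewrite EP => -[|] //.
  have Acw x : A (x * (d * z)) <-> A (x * (c * w)).
    have Axc : A (x * (d * z) - x * (c * w)) by rewrite -mulrBr; apply: ideal_mull.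
    split; apply: ideal_cong => //.
    exact: ideal_congC.
  have nP0c : ~ P0 c.
    rewrite EP0 /= => Acw'; apply: nAdz; have := Acw 1; rewrite !mul1r => ->.
    by [].
  apply/seteqP; split=> x.
    move/EPs/Acw; rewrite mulrA => H; have : P0 (x * c) by rewrite EP0.
    by case: pP0 => _ _ /[apply] -[].
  rewrite EP0 /= => Axw; apply/EPs/Acw; rewrite mulrCA; exact: ideal_mull.
apply/orP; right; apply: PsP; split=> //; exists z.
  by move=> Bz; apply: nB; exists 1; rewrite mul1r.
rewrite EP; apply/seteqP; split=> x /=; first exact: sub_adj.
by move=> Bxz; apply: contrapT => nAxz; apply: nB; exists x.
Qed.

Lemma nonzerodivisor_assoc A u : is_ideal A ->
  (forall P, associated A P -> ~ P u) -> nonzerodivisor A u.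
Proof.
move=> iA nPu y Auy; apply: contrapT => nAy.
by have [P aP AP] := associated_ex iA nAy; apply: (nPu P aP); apply: AP.
Qed.

Lemma assoc_nonzerodivisor A u P :
  associated A P -> nonzerodivisor A u -> ~ P u.
Proof. by move=> [_ [w nAw ->]] nzu /nzu. Qed.

Lemma prime_unit P u v : is_prime P -> u * v = 1 -> ~ P u.
Proof.
by move=> [iP nP1 _] uv Pu; apply: nP1; rewrite -uv; apply: ideal_mulr.
Qed.

Hypothesis nat_unit : forall n, exists v, n.+1%:R * v = 1 :> R.

(** At most one of the elements u + t x lies in P: the difference of two of them is a
    unit times x. *)
Lemma eventually_avoid P u x : is_prime P -> ~ (P u /\ P x) ->
  eventually (fun t => ~ P (u + t%:R * x)).
Proof.
move=> pP nPux; have [[t0 Pt0]|nP] := pselect (exists t0, P (u + t0%:R * x)); last first.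
  by exists 0%N => t _ Pt; apply: nP; exists t.
exists t0.+1 => t t0t Pt; apply: nPux.
have [iP _ Pmul] := pP.
have Px : P x.
  have [v nv] := nat_unit (t - t0.+1); rewrite -subSn // subSS in nv.
  have : P ((t - t0)%:R * x).
    by have := idealB iP Pt Pt0; congr P; rewrite natrB 1?ltnW //; ring.
  by case/Pmul => // /(prime_unit pP nv).
by split=> //; rewrite -(addrK (t0%:R * x) u); apply: idealB => //; apply: ideal_mull.
Qed.

(** The elements of s are added to u one after the other, with a large integer
    coefficient. The sum u + v is used as a new generator in place of u, hence the
    membership of v in (s). *)
Lemma prime_avoidance (Ps : seq (set R)) s u :
  (forall P, P \in Ps -> is_prime P) ->
  exists2 v, ideal_span [set 0] s v &
    forall P, P \in Ps -> (exists2 x, x \in u :: s & ~ P x) -> ~ P (u + v).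
Proof.
move=> pPs; elim: s u => [|x s IH] u.
  by exists 0 => // P _ [y]; rewrite inE => /eqP-> nPu; rewrite addr0.
have [T nT] : eventually (fun t => forall P, P \in Ps -> ~ (P u /\ P x) ->
     ~ P (u + t%:R * x)).
  apply: eventually_all => P PPs.
  have [H|H] := pselect (P u /\ P x); first by exists 0%N => t _ /(_ H).
  by have [T nT] := eventually_avoid (pPs _ PPs) H; exists T => t /nT + _.
have [v sv vP] := IH (u + T%:R * x); exists (T%:R * x + v).
  by exists T%:R; congr (ideal_span _ s _): sv; ring.
move=> P PPs [y yus nPy]; rewrite addrA; apply: vP => //.
have [[Pu Px]|nux] := pselect (P u /\ P x).
  exists y => //; move: yus; rewrite !inE => /or3P[/eqP yu|/eqP yx|->]; last 1 first.
  - by rewrite orbT.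
  - by case: nPy; rewrite yu.
  - by case: nPy; rewrite yx.
by exists (u + T%:R * x); [exact: mem_head|exact: nT].
Qed.

Lemma ideal_avoidance (Ps : seq (set R)) Z : is_ideal Z ->
  (forall P, P \in Ps -> is_prime P) -> (forall P, P \in Ps -> ~ Z `<=` P) ->
  exists2 v, Z v & forall P, P \in Ps -> ~ P v.
Proof.
move=> iZ pPs nZP; have [s Zs] := nR iZ; have [v sv vP] := prime_avoidance s 0 pPs.
exists v; first by rewrite Zs ideal_gen_seq.
move=> P PPs; rewrite -(add0r v); apply: vP => //; apply: contrapT => nP.
apply: (nZP P PPs); rewrite Zs; apply: ideal_gen_min; first by case: (pPs P PPs).
move=> x xs; apply: contrapT => nPx; apply: nP; exists x => //.
by rewrite inE; apply/orP; right.
Qed.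

Lemma ideal_nonzerodivisor A Z : is_ideal A -> is_ideal Z ->
  (forall P, associated A P -> ~ Z `<=` P) -> exists2 v, Z v & nonzerodivisor A v.
Proof.
move=> iA iZ nZP; have [Ps PsP] := associated_finite iA.
have [||v Zv vP] := @ideal_avoidance [seq P <- Ps | `[< associated A P >]] Z iZ.
- by move=> P; rewrite mem_filter => /andP[/asboolP[]].
- by move=> P; rewrite mem_filter => /andP[/asboolP aP _]; apply: nZP.
exists v => //; apply: nonzerodivisor_assoc => // P aP; apply: vP.
by rewrite mem_filter PsP // andbT; apply/asboolP.
Qed.

End Noetherian.

(** * Regular sequences in a Noetherian local ring *)

Section RegularSequences.
Variables (R : comNzRingType) (m : set R).
Hypotheses (nR : noetherian R) (im : is_ideal m) (m1 : ~ m 1).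
Hypothesis m_unit : forall u, ~ m u -> exists v, u * v = 1.
Implicit Types (A B I J L N P Q Z : set R) (a b c u v w x y z : R).
Implicit Types (s t : seq R).

(** By Noetherian induction every ideal strictly above A contains N. If z is in N but not
    in A, this holds for A + (z), while m z lies in A since 1 - d c is a unit for c in m;
    hence m N lies in A, and so does N. *)
Lemma nakayama A N : is_ideal A -> is_ideal N ->
  N `<=` ideal_add A (ideal_mul m N) -> N `<=` A.
Proof.
move=> + iN; move: A; apply: (noetherian_ind nR) => A iA IH NA.
have big B : is_ideal B -> A `<` B -> N `<=` B.
  move=> iB AB; apply: IH => // x /NA[y my Axy]; exists y => //.
  by case: AB => + _; apply.
move=> z Nz; apply: contrapT => nAz.
have iAz := adj_ideal z iA.
have NAz : N `<=` ideal_adj A z.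
  by apply: big => //; split; [exact: sub_adj|move/(_ z (mem_adj z iA))].
have mz c : m c -> A (c * z).
  move=> mc; apply: contrapT => nAcz; apply: nAz.
  have [d Ad] : ideal_adj A (c * z) z.
    apply: big => //; first exact: adj_ideal.
    by split; [exact: sub_adj|move/(_ _ (mem_adj (c * z) iA))].
  have [v uv] : exists v, (1 - d * c) * v = 1.
    apply: m_unit => H; apply: m1; rewrite -(subrK (d * c) 1).
    by apply: idealD => //; apply: ideal_mull.
  have <- : v * (z - d * (c * z)) = z.
    by rewrite -[RHS]mul1r -uv; ring.
  exact: ideal_mull.
apply: nAz; have [y my Azy] := NA z Nz; apply: (ideal_cong iA Azy).
move: y {Azy} my; apply: mul_min => // c y mc /NAz[d Ad].
have := idealD iA (ideal_mull c iA Ad) (ideal_mull d iA (mz c mc)).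
by congr (A _); ring.
Qed.

Fixpoint regular A s : Prop :=
  if s is x :: s' then nonzerodivisor A x /\ regular (ideal_adj A x) s' else True.

(** The annihilator N of y modulo A satisfies N = A + x N, so N = A by Nakayama. *)
Lemma nonzerodivisor_swap A x y : is_ideal A -> m x ->
  nonzerodivisor A x -> nonzerodivisor (ideal_adj A x) y -> nonzerodivisor A y.
Proof.
move=> iA mx nx ny.
suff: [set w | A (w * y)] `<=` A by move=> H w; rewrite mulrC; apply: H.
apply: nakayama => // [|w /= Awy]; first exact: ideal_preim.
have [c Ac] : ideal_adj A x w by apply: ny; apply: sub_adj; rewrite mulrC.
exists (c * x) => //; rewrite mulrC; apply: mem_mul => //=; apply: nx.
by have := idealB iA Awy (ideal_mulr y iA Ac); congr (A _); ring.
Qed.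

(** Permutability of regular sequences, which needs the local hypothesis through
    [nonzerodivisor_swap]. *)
Lemma regular_swap A x y s : is_ideal A -> m x ->
  regular A (x :: y :: s) -> regular A (y :: x :: s).
Proof.
move=> iA mx [nx [ny rs]]; split; first exact: nonzerodivisor_swap nx ny.
split; last by rewrite adjC.
move=> w [c Ac].
have [d Ad] : ideal_adj A x c.
  by apply: ny; exists w; have := idealN iA Ac; congr (A _); ring.
exists d; apply: nx.
by have := idealD iA Ac (ideal_mulr y iA Ad); congr (A _); ring.
Qed.

Lemma regular_cons_mid A x s t : is_ideal A -> m x -> (forall y, y \in s -> m y) ->
  regular A (x :: s ++ t) <-> regular A (s ++ x :: t).
Proof.
move=> + mx; elim: s A => [//|y s IH] A iA ms.
have my : m y by apply: ms; apply: mem_head.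
have {}IH := IH _ (adj_ideal y iA) _; split.
  move/(regular_swap iA mx) => [ny ry]; split=> //; apply/IH => // z zs.
  by apply: ms; rewrite inE zs orbT.
case=> ny ry; apply: regular_swap => //; split=> //; apply/IH => // z zs.
by apply: ms; rewrite inE zs orbT.
Qed.

Lemma regular_last A x s : is_ideal A -> m x -> (forall y, y \in s -> m y) ->
  regular A (x :: s) -> regular A s /\ nonzerodivisor (ideal_span A s) x.
Proof.
move=> iA mx ms; rewrite -(cats0 s) => /(regular_cons_mid [::] iA mx ms).
rewrite cats0; elim: s A {ms} iA => [|y s IH] A iA /=; first by case.
by move=> [ny /(IH _ (adj_ideal y iA))]; rewrite span_adj => -[].
Qed.

Lemma last_regular A x s : is_ideal A -> m x -> (forall y, y \in s -> m y) ->
  regular A s -> nonzerodivisor (ideal_span A s) x -> regular A (x :: s).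
Proof.
move=> iA mx ms rs nx; rewrite -(cats0 s).
apply/(regular_cons_mid [::] iA mx ms).
elim: s A {ms} iA rs nx => [|y s IH] A iA //= [ny rs] nx; split=> //.
by apply: IH => //; [exact: adj_ideal|rewrite span_adj].
Qed.

(** * Depth and grade *)

Hypothesis nat_unit : forall n, exists v, n.+1%:R * v = 1 :> R.

(** Maximal regular sequences have the same length: an arbitrary regular element x
    of Z can replace one member of a regular sequence. The element u chosen below
    is regular both modulo x and modulo y1; swapping u to the front reduces the
    claim for A to the same claim for A + (y1) and A + (u). *)
Lemma regular_exchange Z e A x s : is_ideal Z -> Z `<=` m -> is_ideal A ->
  (forall y, y \in s -> Z y) -> size s = e.+1 -> regular A s ->
  Z x -> nonzerodivisor A x ->
  exists s', [/\ size s' = e, forall y, y \in s' -> Z y & regular (ideal_adj A x) s'].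
Proof.
move=> iZ Zm; elim: e A x s => [|e IH] A x s iA sZ.
  by exists [::].
case: s sZ => [//|y1 [//|y2 s]] sZ [ss] [ny1 [ny2 rs]] Zx nx.
have Zy1 : Z y1 by apply: sZ; rewrite mem_head.
have Zy2 : Z y2 by apply: sZ; rewrite !inE eqxx orbT.
have iAx := adj_ideal x iA; have iAy := adj_ideal y1 iA.
have [Ps PsP] := associated_finite nR iAx; have [Qs QsQ] := associated_finite nR iAy.
have [||u Zu uP] := @ideal_avoidance _ nR nat_unit
    [seq P <- Ps ++ Qs | `[< associated (ideal_adj A x) P \/
                            associated (ideal_adj A y1) P >]] Z iZ.
- by move=> P; rewrite mem_filter => /andP[/asboolP[[]|[]]].
- move=> P; rewrite mem_filter => /andP[/asboolP[aP|aP] _] ZP; last first.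
    by apply: (assoc_nonzerodivisor aP ny2); apply: ZP.
  (* y1 w = x v modulo A transports the annihilated class w of R/(A + (x)) to a
     class v of R/(A + (y1)) annihilated by Z. *)
  case: aP => _ [w nw EP].
  have Zw c : Z c -> ideal_adj A x (c * w) by move/ZP; rewrite EP.
  have [v Av] := Zw y1 Zy1.
  apply: nw; have [b Ab] : ideal_adj A y1 v.
    apply: ny2; have [c Ac] := Zw y2 Zy2.
    exists c; apply: nx.
    have := idealB iA (ideal_mull y1 iA Ac) (ideal_mull y2 iA Av).
    by congr (A _); ring.
  exists b; apply: ny1.
  by have := idealD iA Av (ideal_mull x iA Ab); congr (A _); ring.
have nux : nonzerodivisor (ideal_adj A x) u.
  apply: nonzerodivisor_assoc => // P aP; apply: uP.
  by rewrite mem_filter mem_cat PsP // andbT; apply/asboolP; left.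
have nuy : nonzerodivisor (ideal_adj A y1) u.
  apply: nonzerodivisor_assoc => // P aP; apply: uP.
  by rewrite mem_filter mem_cat QsQ // orbT andbT; apply/asboolP; right.
have ss' : size (y2 :: s) = e.+1 by rewrite /= ss.
have [||||s1 [ss1 s1Z rs1]] := IH _ u (y2 :: s) iAy _ ss' => //.
  by move=> y ys; apply: sZ; rewrite inE ys orbT.
rewrite adjC in rs1.
have [nu [ny _]] : regular A [:: u; y1] by apply: regular_swap => //; exact: Zm.
have [nu' [nx' _]] : regular A [:: u; x] by apply: regular_swap => //; exact: Zm.
have [|||||s2 [ss2 s2Z rs2]] := IH _ x (y1 :: s1) (adj_ideal u iA); rewrite /= ?ss1 //.
  by move=> y; rewrite inE => /orP[/eqP->|/s1Z].
exists (u :: s2); split; [by rewrite /= ss2| |by rewrite /= adjC].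
by move=> y; rewrite inE => /orP[/eqP->|/s2Z].
Qed.

(** By prime avoidance z can be corrected by a combination of the other generators to a
    regular element x. The others are regular modulo x by induction, thanks to
    [regular_exchange]; then x, and with it z, is regular modulo the others. *)
Lemma regular_of_grade A s : is_ideal A -> A `<=` m -> (forall y, y \in s -> m y) ->
  (exists s', [/\ size s' = size s, forall y, y \in s' -> ideal_span A s y &
                  regular A s']) ->
  regular A s.
Proof.
elim: s A => [//|z s IH] A iA Am ms [s0 [ss0 sZ rs0]].
case: s0 ss0 sZ rs0 => [//|y1 s'] [ss'] sZ rs'.
have mz : m z by apply: ms; apply: mem_head.
have ms' y : y \in s -> m y by move=> ys; apply: ms; rewrite inE ys orbT.
have [Ps PsP] := associated_finite nR iA.
have [|v sv vP] := @prime_avoidance _ nat_unit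
    [seq P <- Ps | `[< associated A P >]] s z.
  by move=> P; rewrite mem_filter => /andP[/asboolP[]].
have sAv : ideal_span A s v.
  by apply: (span_mono _ sv) => w ->; apply: ideal0.
pose x := z + v.
have nx : nonzerodivisor A x.
  apply: nonzerodivisor_assoc => // P aP; apply: vP.
    by rewrite mem_filter PsP // andbT; apply/asboolP.
  apply: contrapT => nP; apply: (assoc_nonzerodivisor aP (proj1 rs')).
  have [[iP _ _] [w _ EP]] := aP.
  have AP : A `<=` P by move=> a Aa; rewrite EP /=; apply: ideal_mulr.
  have Py y : y \in z :: s -> P y.
    by move=> yzs; apply: contrapT => nPy; apply: nP; exists y.
  by apply: (span_min iP AP Py); apply: sZ; apply: mem_head.
have EZ : ideal_adj (ideal_span A s) x = ideal_adj (ideal_span A s) z.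
  by apply: adj_cong; [exact: span_ideal|rewrite /x (addrC z) addrK].
have mx : m x.
  apply: (span_min im Am ms); rewrite /= -EZ; apply: mem_adj; exact: span_ideal.
have [|||||t [st tZ rt]] := @regular_exchange (ideal_adj (ideal_span A s) z) (size s)
  A x (y1 :: s') _ _ iA sZ _ rs'.
- by apply: adj_ideal; apply: span_ideal.
- exact: (span_min (s := z :: s) im Am ms).
- by rewrite /= ss'.
- by rewrite -EZ; apply: mem_adj; apply: span_ideal.
- by [].
have rx : regular A (x :: s).
  split=> //; apply: IH => //; first exact: adj_ideal.
    exact: adj_min.
  by exists t; split=> // y /tZ; rewrite span_adj EZ.
have [rs nxs] := regular_last iA mx ms' rx.
apply: last_regular => // w sw; apply: nxs.
have iS := span_ideal s iA.
by have := idealD iS sw (ideal_mulr w iS sAv); congr (ideal_span A s _); rewrite /x; ring.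
Qed.

(** By Nakayama the elements killed by P modulo A are not all in A + (y), so P + (y) is
    contained in a prime associated to A + (y); it is larger than P as y is regular. *)
Lemma chain_above A P s : is_ideal A -> (forall y, y \in s -> m y) ->
  regular A s -> associated A P ->
  exists C, prime_chain (size s) C /\ C 0%N = P.
Proof.
elim: s A P => [|y s IH] A P iA ms.
  by move=> _ [pP _]; exists (fun=> P); split=> //; split=> // i; rewrite ltn0.
move=> [ny rs] aP; have [pP [z nAz EP]] := aP.
have my : m y by apply: ms; apply: mem_head.
have iAy := adj_ideal y iA.
have [w [Nw nyw]] : exists w, (forall p, P p -> A (p * w)) /\ ~ ideal_adj A y w.
  apply: contrapT => H; apply: nAz.
  have iN : is_ideal [set w | forall p, P p -> A (p * w)].
    split=> /= [p _|u v Nu Nv p Pp|a u Nu p Pp].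
    - by rewrite mulr0; apply: ideal0.
    - by rewrite mulrDr; apply: idealD; auto.
    - by rewrite mulrCA; apply: ideal_mull; auto.
  apply: (nakayama iA iN); last by move=> p; rewrite EP.
  move=> w Nw; have [c Ac] : ideal_adj A y w.
    by apply: contrapT => nyw; apply: H; exists w.
  exists (c * y) => //; rewrite mulrC; apply: mem_mul => // p Pp.
  apply: ny; have := idealB iA (Nw p Pp) (ideal_mull p iA Ac).
  by congr (A _); ring.
have [Q aQ QP] := associated_ex nR iAy nyw.
have [|C [[pC CS] C0]] := IH _ Q iAy _ rs aQ.
  by move=> v vs; apply: ms; rewrite inE vs orbT.
exists (fun i => if i is j.+1 then C j else P); split=> //; split.
  by case=> [|i] //=; apply: pC.
case=> [_|i]; last exact: CS.
rewrite C0; split=> [p Pp|QP'].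
  by apply: QP; apply: sub_adj; apply: Nw.
apply: (assoc_nonzerodivisor aP ny); apply: QP'; apply: QP.
by rewrite mulrC; exists w; rewrite subrr; apply: ideal0.
Qed.

Lemma prime_chain_cat n e (C D : nat -> set R) :
  prime_chain n C -> prime_chain e D -> C n = D 0%N ->
  exists E : nat -> set R, prime_chain (n + e) E.
Proof.
move=> [pC CS] [pD DS] CD; exists (fun i => if (i < n)%N then C i else D (i - n)%N).
split=> i ine.
  by case: ltnP => in'; [apply: pC; lia|apply: pD; lia].
case: ltnP => [in'|ni]; last first.
  by rewrite ltnNge (leqW ni) /= subSn //; apply: DS; lia.
case: ltnP => [in''|ni]; first by apply: CS; lia.
have -> : i.+1 = n by lia.
by rewrite subnn -CD (_ : n = i.+1); [apply: CS; lia|lia].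
Qed.

(** Heights are relations with values in nat; finite dimension makes them total. *)
Lemma prime_height_ex d Q : krull_dim R d -> is_prime Q ->
  exists n, prime_height Q n /\ (n <= d)%N.
Proof.
move=> [_ dmax] pQ.
pose p n := `[< exists C, prime_chain n C /\ C n = Q >].
have ex_p : exists n, p n.
  exists 0%N; apply/asboolP; exists (fun=> Q); split; last by [].
  by split; [move=> i _|move=> i; rewrite ltn0].
have p_le n : p n -> (n <= d)%N by move=> /asboolP[C [cC _]]; apply: dmax cC.
case: (ex_maxnP ex_p p_le) => n pn nmax; exists n; split; last exact: p_le.
split; first exact/asboolP.
by move=> n' C cC CQ; apply: nmax; apply/asboolP; exists C.
Qed.

(** If B consisted of zerodivisors modulo a regular sequence of length g < h in B, it
    would lie in an associated prime P, and a chain of length at least h below P continued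
    by one of length d - g above P would be longer than the dimension d. *)
Lemma grade_height d h B : krull_dim R d -> depth m d -> is_ideal B -> B `<=` m ->
  (forall Q n, is_prime Q -> B `<=` Q -> prime_height Q n -> (h <= n)%N) ->
  exists s, [/\ size s = h, forall y, y \in s -> B y & regular [set 0] s].
Proof.
move=> dimR [[y [ym [ry _] sy]] _] iB Bm hB.
have i0 := @ideal_set0 R.
have pm : is_prime m.
  split=> // u v muv; have [mu|/m_unit[u' uu']] := pselect (m u); first by left.
  have -> : v = u' * (u * v) by rewrite mulrA [u' * u]mulrC uu' mul1r.
  by right; apply: ideal_mull.
have hd : (h <= d)%N.
  by have [n [mn nd]] := prime_height_ex dimR pm; apply: leq_trans (hB _ _ pm Bm mn) nd.
have reg_y : regular [set 0] y.
  have: forall i x, (i < size y)%N -> ideal_span [set 0] (take i y) (y`_i * x) ->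
      ideal_span [set 0] (take i y) x.
    by move=> i x; rewrite -ideal_gen_seq; apply: ry.
  elim: y [set 0] i0 {ym ry sy} => [//|v y IH] A iA H; split; first by move=> x; exact: (H 0%N x isT).
  apply: IH; first exact: adj_ideal.
  by move=> i x iy; have := H i.+1 x iy; rewrite /= span_adj.
suff [s [[ss sB rs] _]] : exists s,
    [/\ size s = h, forall x, x \in s -> B x & regular [set 0] s] /\
    exists s', [/\ size s' = (d - h)%N, forall x, x \in s' -> m x &
                   regular (ideal_span [set 0] s) s'].
  by exists s.
move: {-2}h (leqnn h); elim=> [_|g IH gh].
  exists [::]; split=> //; exists y; split=> //; first by rewrite subn0.
have [s [[ss sB rs] [s' [ss' s'm rs']]]] := IH (ltnW gh).
have iA := span_ideal s i0.
have [v Bv nv] : exists2 v, B v & nonzerodivisor (ideal_span [set 0] s) v.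
  apply: ideal_nonzerodivisor => // P aP BP.
  have [n [Pn _]] := prime_height_ex dimR (proj1 aP).
  have [D [cD D0]] := chain_above iA s'm rs' aP.
  have [[[C [cC Cn]] _] hn] := (Pn, hB _ _ (proj1 aP) BP Pn).
  have [E cE] := prime_chain_cat cC cD (etrans Cn (esym D0)).
  have := dimR.2 _ _ cE; rewrite ss'; lia.
exists (v :: s); split.
  split; [by rewrite /= ss|by move=> x; rewrite inE => /orP[/eqP->|/sB]|].
  by apply: last_regular => //; [exact: Bm|move=> x /sB /Bm].
have [|||t [st tm rt]] := @regular_exchange m (d - g.+1) _ v s' im _ iA s'm _ rs' _ nv.
- by [].
- by rewrite ss'; lia.
- exact: Bm.
by exists t.
Qed.

End RegularSequences.

(** * Existence and genericity of reductions *)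

Lemma eventually_nonroot (k : fieldType) (q : {poly k}) :
  [pchar k] =i pred0 -> q != 0 -> eventually (fun t => q.[t%:R] != 0).
Proof.
move=> /pcharf0P k0; elim: {q}(size q) {-2}q (leqnn (size q)) => [|n IH] q.
  by rewrite leqn0 size_poly_eq0 => /eqP->; rewrite eqxx.
move=> qn q0; have [[t0 /rootP/factor_theorem[p qE]]|nr] :=
  pselect (exists t0, q.[t0%:R] = 0); last first.
  by exists 0%N => t _; apply/eqP => qt; apply: nr; exists t.
have p0 : p != 0 by apply: contraNneq q0 => p0; rewrite qE p0 mul0r.
have [||T pT] := IH p => //.
  by move: qn; rewrite qE size_mul ?polyXsubC_eq0 // size_XsubC addn2.
exists (maxn T t0.+1) => t; rewrite geq_max => /andP[Tt t0t].
rewrite qE hornerM hornerXsubC mulf_neq0 ?pT // -natrB ?k0 ?subn_eq0; last exact: ltnW.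
by rewrite -ltnNge.
Qed.

Section Reductions.
Variables (R : comNzRingType) (m : set R) (k : fieldType) (pi : {rmorphism R -> k}).
Hypotheses (nR : noetherian R) (im : is_ideal m) (m1 : ~ m 1).
Hypothesis m_unit : forall u, ~ m u -> exists v, u * v = 1.
Hypotheses (pi_m : forall x, pi x = 0 <-> m x) (k_char0 : [pchar k] =i pred0).
Implicit Types (A B I K L N P Q Z : set R) (a b c u v w x y z : R).
Implicit Types (s : seq R) (t : nat).

(** For an ideal I: (s) is a reduction of I with reduction number at most n; the other
    inclusion between the two products is automatic. *)
Definition reduces n I s :=
  (forall x, x \in s -> I x) /\
  ideal_pow I n.+1 `<=` ideal_mul (ideal_span [set 0] s) (ideal_pow I n).

Lemma sub_reduces n I s : is_ideal I -> reduces n I s -> ideal_span [set 0] s `<=` I.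
Proof. by move=> iI [sI _]; apply: span_min => // x ->; apply: ideal0. Qed.

Lemma eq_reduces_mem n I s s' : s =i s' -> reduces n I s -> reduces n I s'.
Proof.
move=> ss' [sI rs]; split=> [x|]; first by rewrite -ss'; apply: sI.
by rewrite -(eq_span_mem (@ideal_set0 R) ss').
Qed.

Lemma reduces_ge n p I s : is_ideal I -> (n <= p)%N ->
  reduces n I s -> reduces p I s.
Proof. by move=> iI np [sI rs]; split=> //; apply: reduction_ge rs. Qed.

Lemma reduces_is_reduction n I s : is_ideal I -> reduces n I s ->
  is_reduction I (ideal_span [set 0] s).
Proof.
move=> iI rs; have sI := sub_reduces iI rs.
split=> //; first exact/span_ideal/ideal_set0.
by exists n; apply/seteqP; split; [apply: mul_mono|case: rs].
Qed.

Lemma span_coord s x : ideal_span [set 0] s x ->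
  exists c : 'I_(size s) -> R, x = \sum_i c i * s`_i.
Proof.
elim: s x => [|y s IH] x /=; first by move=> ->; exists (fun=> 0); rewrite big_ord0.
move=> [d /IH[c xE]].
exists (fun i : 'I_(size s).+1 => if unlift ord0 i is Some j then c j else d).
rewrite big_ord_recl unlift_none /=.
under eq_bigr do rewrite liftK.
by rewrite -xE addrC subrK.
Qed.

(** Being a reduction is an open condition. If w generates I^(n+1) = (a) I^n, then
    (a + t b) I^n contains (1 + t M) w for a fixed matrix M, and det(1 + t M), a
    polynomial in t with value 1 at t = 0, is a unit for all large integers t. *)
Lemma eventually_reduces n I (l : seq (R * R)) : is_ideal I ->
  reduces n I (unzip1 l) -> (forall p, p \in l -> I p.2) ->
  eventually (fun t => reduces n I [seq p.1 + t%:R * p.2 | p <- l]).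
Proof.
move=> iI [lI rl] lI2; have [w wE] := nR (pow_ideal I n.+1).
pose B t := ideal_mul (ideal_span [set 0] [seq p.1 + t%:R * p.2 | p <- l]) (ideal_pow I n).
have iB t : is_ideal (B t) by apply: mul_ideal.
pose E := [set z | exists c : 'I_(size w) -> R,
  forall t, B t (z + t%:R * \sum_i c i * w`_i)].
have iE : is_ideal E.
  split=> [|x y [c Bc] [d Bd]|a x [c Bc]].
  - exists (fun=> 0) => t; rewrite big1 => [|i _]; last exact: mul0r.
    by rewrite mulr0 addr0; apply: ideal0.
  - exists (fun i => c i + d i) => t; have := idealD (iB t) (Bc t) (Bd t).
    under [in X in _ -> X]eq_bigr do rewrite mulrDl.
    by rewrite big_split /=; congr (B t _); ring.
  - exists (fun i => a * c i) => t; have := ideal_mull a (iB t) (Bc t).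
    under [in X in _ -> X]eq_bigr do rewrite -mulrA; rewrite -mulr_sumr.
    by congr (B t _); ring.
have IE : ideal_pow I n.+1 `<=` E.
  apply: subset_trans rl _; apply: mul_min => // x y + Iy; move: x.
  apply: (span_min (ideal_preim y iE)).
    by move=> _ ->; rewrite /= mul0r; apply: ideal0.
  move=> _ /mapP[p pl ->] /=.
  have [c cE] : exists c : 'I_(size w) -> R, p.2 * y = \sum_i c i * w`_i.
    apply: span_coord; rewrite -ideal_gen_seq -wE; apply: mem_mul => //.
    exact: lI2.
  exists c => t; rewrite -cE mulrA -mulrDl; apply: mem_mul => //.
  by apply: mem_span; [exact: ideal_set0|apply/mapP; exists p].
have /choice[M MB] (i : 'I_(size w)) : exists c : 'I_(size w) -> R,
    forall t, B t (w`_i + t%:R * \sum_j c j * w`_j).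
  by apply: IE; rewrite wE; apply: sub_ideal_gen => /=; apply: mem_nth.
pose MM := \matrix_(i, j) M i j.
pose q := \det (1%:M + 'X *: map_mx polyC (map_mx pi MM)).
have qE t : q.[t%:R] = pi (\det (1%:M + t%:R *: MM)).
  rewrite -horner_evalE -!det_map_mx; congr (\det _); apply/matrixP => i j.
  rewrite !mxE /= /horner_eval !hornerE rmorphD rmorphM /= !rmorph_nat.
  by case: (i == j); rewrite hornerE.
have q0 : q != 0.
  apply: contraTneq isT => q0; have := qE 0%N.
  rewrite q0 horner0 mulr0n scale0r addr0 det1 rmorph1 => /eqP.
  by rewrite eq_sym oner_eq0.
have [T qT] := eventually_nonroot k_char0 q0.
exists T => t /qT; rewrite qE => /eqP dt.
set D := 1%:M + t%:R *: MM in dt.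
have [v Dv] : exists v, \det D * v = 1 by apply: m_unit => /pi_m.
split=> [_ /mapP[p pl ->]|].
  by apply: idealD => //; [apply: lI; apply: map_f|apply: ideal_mull => //; apply: lI2].
rewrite wE; apply: ideal_gen_min; first exact: iB.
move=> x /= /(nthP 0)[i iw <-]; rewrite -/(B t).
pose W := \col_j w`_j : 'cV_(size w).
have BD j : B t ((D *m W) j 0).
  have := MB j t; congr (B t _); rewrite mulmxDl mul1mx -scalemxAl !mxE.
  by congr (_ + _ * _); apply: eq_bigr => l' _; rewrite !mxE.
have DE : (\adj D *m (D *m W)) (Ordinal iw) 0 = \det D * w`_i.
  by rewrite mulmxA mul_adj_mx mul_scalar_mx !mxE.
rewrite mxE in DE.
rewrite -(mul1r w`_i) -Dv mulrAC -DE mulrC; apply: (ideal_mull v (iB t)).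
apply: (@ideal_sum _ (B t) _ (index_enum _) xpredT _ (iB t)) => j _.
exact: ideal_mull (iB t) (BD j).
Qed.

(** Gaussian elimination in (s)/m(s), a vector space over the residue field: a proper
    subspace is contained in the span of fewer elements than the list s has. If L
    contains an element with unit coefficient at b, it serves as a pivot; otherwise b
    can be dropped. *)
Lemma subideal_elimination L s : is_ideal L ->
  let S := ideal_span [set 0] s in
  S `<=` ideal_add L (ideal_mul m S) \/
  exists s', [/\ size s = (size s').+1, forall x, x \in s' -> S x &
    forall x, L x -> S x -> ideal_add (ideal_span [set 0] s') (ideal_mul m S) x].
Proof.
move=> iL; have i0 := @ideal_set0 R.
elim: s => [|b s IH] S.
  left=> x ->; exists 0; first by apply: ideal0; apply: mul_ideal.
  by rewrite subr0; apply: ideal0.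
set S0 := ideal_span [set 0] s in IH.
have iS0 : is_ideal S0 by apply: span_ideal.
have iS : is_ideal S by apply: span_ideal.
have S0S : S0 `<=` S by apply: sub_adj.
have mS0S : ideal_mul m S0 `<=` ideal_mul m S by apply: mul_mono.
have imS := mul_ideal m S.
have [[l Ll S0l]|nl] := pselect (exists2 l, L l & S0 (l - b)); last first.
  right; exists s; split=> // [x xs|x Lx [c S0x]].
    by apply: S0S; apply: mem_span.
  exists (c * b) => //; apply: mem_mul; last exact: mem_adj.
  apply: contrapT => /m_unit[v cv]; apply: nl; exists (v * x); first exact: ideal_mull.
  have -> : v * x - b = v * (x - c * b) by rewrite mulrBr mulrA [v * c]mulrC cv mul1r.
  exact: ideal_mull.
have lb x c : S0 (x - c * b) -> S0 (x - c * l).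
  by move=> S0x; have := idealB iS0 S0x (ideal_mull c iS0 S0l); congr (S0 _); ring.
have Sl : S l by exists 1; rewrite mul1r.
case: IH => [S0L|[s' [ss' s'S0 LS0]]].
  left; apply: adj_min; first exact: add_ideal.
    by move=> x /S0L[z mz Lz]; exists z => //; apply: mS0S.
  have [z mz Lz] := S0L _ S0l; exists (- z); first exact: (idealN imS (mS0S _ mz)).
  by have := idealB iL Ll Lz; congr (L _); ring.
right; exists (l :: s'); split=> [|x|x Lx [c S0x]]; first by rewrite /= ss'.
  by rewrite inE => /orP[/eqP->//|/s'S0/S0S].
have [|z mz s'z] := LS0 (x - c * l) _ (lb _ _ S0x).
  by apply: idealB => //; apply: ideal_mull.
exists z; first exact: mS0S.
by exists c; congr (ideal_span _ s' _): s'z; ring.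
Qed.

(** Take generators of a reduction inside K, as few as possible. A smaller reduction L
    of (s) not covering (s) modulo m(s) would, by Nakayama, lead to a reduction with fewer
    generators. *)
Lemma minimal_reduction_ex I K : is_ideal I -> is_reduction I K ->
  exists2 L, is_minimal_reduction I L & L `<=` K.
Proof.
move=> iI [iK KI [n0 Kn0]]; have i0 := @ideal_set0 R.
pose p d := `[< exists s, [/\ size s = d, forall x, x \in s -> K x & exists n, reduces n I s] >].
have ex_p : exists d, p d.
  have [s Ks] := nR iK; exists (size s); apply/asboolP; exists s.
  have sK x : x \in s -> K x by move=> xs; rewrite Ks; apply: sub_ideal_gen.
  split=> //; exists n0; split=> [x /sK/KI//|].
  by rewrite -ideal_gen_seq -Ks Kn0.
case: (ex_minnP ex_p) => d /asboolP[s [sd sK [n rs]]] dmin.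
have sKsub : ideal_span [set 0] s `<=` K.
  by apply: span_min => // x ->; apply: ideal0.
exists (ideal_span [set 0] s) => //.
split; first exact: reduces_is_reduction rs.
move=> L [iL LI [n' Ln']] Ls.
case: (subideal_elimination s iL) => [sL|[s' [ss' s's Ls']]].
  apply/seteqP; split=> //.
  by apply: (nakayama nR im m1 m_unit iL _ sL); apply: span_ideal.
suff : (d <= size s')%N by rewrite -sd ss' ltnn.
apply: dmin; apply/asboolP; exists s'; split=> // [x /s's/sKsub//|].
exists n'; split=> [x /s's|]; first exact: (sub_reduces iI rs).
apply: (nakayama nR im m1 m_unit); do ?[exact: mul_ideal].
rewrite -{1}Ln'; apply: mul_min; first by apply: add_ideal; apply: mul_ideal.
move=> l y Ll Iy; have [z mz s'z] := Ls' l Ll (Ls l Ll).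
exists (z * y); last by rewrite -mulrBl; apply: mem_mul.
move: z mz {s'z}; apply: (mul_min (ideal_preim y (mul_ideal _ _))) => c x mc sx /=.
rewrite -mulrA; apply: mem_mul => //; apply: mem_mul => //.
exact: (sub_reduces iI rs).
Qed.

End Reductions.

(** * Powers of regular sequences *)

Section Powers.
Variable R : comNzRingType.
Implicit Types (A B C I J L P Q Z m : set R) (a b c u v w x y z : R).
Implicit Types (s : seq R) (l : seq (R * nat)) (N : nat).

(** A list of pairs (a, n) carries the exponents along with the generators. They are
    shifted by one, so that the exponents n add up to N in (s)^(N+1). *)
Definition powers l : seq R := [seq p.1 ^+ p.2.+1 | p <- l].

Definition total l := sumn (unzip2 l).

Lemma perm_powers l l' A : is_ideal A -> perm_eq l l' ->
  ideal_span A (powers l) = ideal_span A (powers l').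
Proof. by move=> iA ll'; apply: eq_span_mem => //; apply/perm_mem/perm_map. Qed.

Lemma perm_total l l' : perm_eq l l' -> total l = total l'.
Proof. by move=> ll'; apply/perm_sumn/perm_map. Qed.

Lemma add_adj A B x : ideal_add (ideal_adj A x) B = ideal_adj (ideal_add A B) x.
Proof.
apply/seteqP; split=> z.
  by case=> b Bb [c Ac]; exists c; exists b => //; congr (A _): Ac; ring.
by case=> c [b Bb Ac]; exists b => //; exists c; congr (A _): Ac; ring.
Qed.

(** Pigeonhole principle: a product of p + q - 1 elements of B + (a) has p factors in (a)
    or q factors in B. *)
Lemma pow_adj_min B C a n p q : is_ideal B -> is_ideal C -> (p + q)%N = n.+1 ->
  C (a ^+ p) -> ideal_pow B q `<=` C -> ideal_pow (ideal_adj B a) n `<=` C.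
Proof.
move=> iB; elim: n p q C => [|n IH] p q C iC pq Ca BC.
  have /orP[/eqP p0|/eqP q0] : (p == 0)%N || (q == 0)%N by move: pq; lia.
    by move=> x _; rewrite -(mulr1 x); move: Ca; rewrite p0; apply: ideal_mull.
  by move=> x _; apply: BC; rewrite q0.
case: p pq Ca => [|p] pq Ca.
  by move=> x _; rewrite -(mulr1 x); apply: (ideal_mull _ iC Ca).
case: q pq BC => [|q] pq BC; first by move=> x _; apply: BC.
apply: mul_min => // x z [c Bx] Bz.
have -> : x * z = z * (x - c * a) + c * (z * a) by ring.
apply: idealD => //; last apply: ideal_mull => //.
  move: z Bz; apply: (IH p.+1 q); first exact: ideal_preim.
  - by move: pq; lia.
  - by rewrite /=; apply: ideal_mulr.
  - by move=> b Bb /=; apply: BC; rewrite mulrC; apply: mem_mul.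
move: z Bz; apply: (IH p q.+1); first exact: ideal_preim.
- by move: pq; lia.
- by rewrite /= -exprSr.
- by move=> b Bb /=; apply: ideal_mulr => //; apply: BC.
Qed.

Lemma pow_span_powers A l : is_ideal A ->
  ideal_pow (ideal_span A (unzip1 l)) (total l).+1 `<=` ideal_span A (powers l).
Proof.
move=> iA; elim: l => [|[a n] l IH] /=; first exact: mul_subl.
have := @pow_adj_min (ideal_span A (unzip1 l)) (ideal_adj (ideal_span A (powers l)) (a ^+ n.+1))
  a (total ((a, n) :: l)).+1 n.+1 (total l).+1; apply.
- exact: span_ideal.
- by apply: adj_ideal; apply: span_ideal.
- by rewrite /total /=; lia.
- by apply: mem_adj; apply: span_ideal.
- by apply: subset_trans IH _; apply: sub_adj.
Qed.

Lemma nonzerodivisor_exp A a n : nonzerodivisor A a -> nonzerodivisor A (a ^+ n).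
Proof.
move=> na; elim: n => [|n IH] y; first by rewrite mul1r.
by rewrite exprS -mulrA => /na/IH.
Qed.

(** The decomposition (L, a)^(N+1) = cap_i (L^(i+1), a^(N-i+1)), relative to A. By the
    member for i = N + 1 of the family, y is a multiple a c modulo A and a power of L, and
    cancelling a in the other members yields the hypothesis for c and N. *)
Lemma adj_pow_cap A L a N y : is_ideal A -> is_ideal L ->
  (forall i, nonzerodivisor (ideal_add A (ideal_pow L i)) a) ->
  (forall i, (i <= N)%N ->
     ideal_adj (ideal_add A (ideal_pow L i.+1)) (a ^+ (N - i).+1) y) ->
  ideal_add A (ideal_pow (ideal_adj L a) N.+1) y.
Proof.
move=> iA iL na; have iAL i : is_ideal (ideal_add A (ideal_pow L i)).
  by apply: add_ideal => //; apply: pow_ideal.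
have iLa := adj_ideal a iL.
elim: N y => [|N IH] y capy.
  have [c [b Lb Ab]] := capy 0%N (leqnn _).
  exists (c * a + b); last by congr (A _): Ab; rewrite expr1; ring.
  rewrite pow1 //; apply: (idealD iLa); last by apply: sub_adj; rewrite -(pow1 iL).
  by apply: (ideal_mull _ iLa); apply: mem_adj.
have [c [b Lb Ab]] := capy N.+1 (leqnn _); rewrite subnn expr1 in Ab.
have [f Lf Af] : ideal_add A (ideal_pow (ideal_adj L a) N.+1) c.
  apply: IH => i iN.
  have [d [b' Lb' Ab']] := capy i (leqW iN).
  exists d; apply: (na i.+1).
  exists (b' - b).
    by apply: (idealB (pow_ideal _ _)) => //; apply: (pow_decr _ Lb); lia.
  have := idealB iA Ab' Ab; rewrite subSn // [a ^+ _.+2]exprS; congr (A _); ring.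
exists (a * f + b).
  apply: (idealD (pow_ideal _ _)).
    by apply: mem_mul => //; apply: mem_adj.
  by apply: (pow_mono _ Lb); apply: sub_adj.
by have := idealD iA Ab (ideal_mull a iA Af); congr (A _); ring.
Qed.

(** For a regular sequence s all of whose powers are regular too, (s)^(N+1) is the
    intersection of the ideals (s_i^(n_i+1))_i with sum n_i = N, as for a power of the
    ideal of the variables in a polynomial ring. Splitting off the first generator
    reduces this to [adj_pow_cap]; the base ideal A then absorbs a power of it. *)
Lemma pow_cap m A a s N y : noetherian R -> is_ideal m -> ~ m 1 ->
  (forall u, ~ m u -> exists v, u * v = 1) -> is_ideal A ->
  (forall x, x \in a :: s -> m x) ->
  (forall l, unzip1 l = a :: s -> regular A (powers l)) ->
  (forall l, unzip1 l = a :: s -> total l = N -> ideal_span A (powers l) y) ->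
  ideal_add A (ideal_pow (ideal_span [set 0] (a :: s)) N.+1) y.
Proof.
move=> nR im m1 m_unit; have i0 := @ideal_set0 R.
elim: s a A N y => [|b s IH] a A N y iA sm reg capy.
  have [c Ac] : ideal_adj A (a ^+ N.+1) y by apply: (capy [:: (a, N)]); rewrite // /total /= addn0.
  exists (c * a ^+ N.+1) => //; apply: (ideal_mull _ (pow_ideal _ _)).
  by apply: mem_pow; apply: mem_adj.
set L := ideal_span [set 0] (b :: s).
have iL : is_ideal L by apply: span_ideal.
have ma : m a by apply: sm; apply: mem_head.
have sm' x : x \in b :: s -> m x by move=> xs; apply: sm; rewrite inE xs orbT.
have pow_sub l : unzip1 l = b :: s ->
    ideal_add A (ideal_pow L (total l).+1) `<=` ideal_span A (powers l).
  move=> lE; apply: add_min; [exact: span_ideal|exact: sub_span|].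
  apply: (subset_trans _ (pow_span_powers (l := l) iA)); apply: pow_mono; rewrite lE.
  by apply: span_mono => _ ->; apply: ideal0.
have powm l : unzip1 l = b :: s -> forall x, x \in powers l -> m x.
  move=> lE _ /mapP[p pl ->]; rewrite exprS; apply: ideal_mulr => //; apply: sm'.
  by rewrite -lE map_f.
have regl l q : unzip1 l = b :: s -> regular A (a ^+ q.+1 :: powers l).
  by move=> lE; apply: (reg ((a, q) :: l)); rewrite /= lE.
apply: adj_pow_cap => //.
- case=> [|j] z az; first by exists z => //; rewrite subrr; apply: ideal0.
  apply: IH => // [l lE|l lE lj].
    by have [] := regular_last nR im m1 m_unit iA ma (powm l lE) (regl l 0%N lE).
  have [_] := regular_last nR im m1 m_unit iA ma (powm l lE) (regl l 0%N lE).
  by apply; apply: (pow_sub l lE); rewrite lj.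
- move=> i iN; rewrite -add_adj; apply: IH => // [|l lE|l lE li].
  + exact: adj_ideal.
  + by have [] := regl l (N - i)%N lE.
  + rewrite span_adj; apply: (capy ((a, (N - i)%N) :: l)); first by rewrite /= lE.
    by rewrite /total /= -/(total l) li subnK.
Qed.

End Powers.

(** * Comparing two reductions *)

Section Comparison.
Variables (R : comNzRingType) (I : set R) (h : nat).
Hypothesis iI : is_ideal I.
Implicit Types (A B K L N P Q Z : set R) (a b c u v w x y z : R).
Implicit Types (s : seq R) (l : seq (R * nat)) (t n : nat).

(** In a Cohen-Macaulay local ring this holds for proper ideals I of height h, by
    [parameters_regular]. *)
Hypothesis regular_mod : forall a s n, size (a :: s) = h ->
  (forall x, x \in a :: s -> I x) ->
  ideal_pow I n `<=` ideal_span [set 0] (a :: s) ->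
  nonzerodivisor (ideal_span [set 0] s) a.

Let i0 := @ideal_set0 R.

Lemma pow_mul A B n p : is_ideal A -> ideal_pow A n `<=` B ->
  ideal_pow A (n * p) `<=` ideal_pow B p.
Proof.
move=> iA AB; elim: p => [|p IH] //; rewrite mulnS.
apply: powD_min; first exact: mul_ideal.
by move=> x y /AB Bx /IH By; apply: mem_mul.
Qed.

Lemma reduces_pow n s : reduces n I s -> ideal_pow I n.+1 `<=` ideal_span [set 0] s.
Proof. by move=> [_ rs]; apply: (subset_trans rs); apply: mul_subl; apply: span_ideal. Qed.

Lemma mem_powers l x : (forall x, x \in unzip1 l -> I x) -> x \in powers l -> I x.
Proof.
move=> lI /mapP[p pl ->]; rewrite exprS; apply: (ideal_mulr _ iI); apply: lI.
exact: map_f.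
Qed.

Lemma reduces_nonzerodivisor n a l : reduces n I (a :: unzip1 l) ->
  size (a :: unzip1 l) = h -> nonzerodivisor (ideal_span [set 0] (powers l)) a.
Proof.
move=> rs sh; have [sI _] := rs.
pose l0 := (a, 0%N) :: l.
have := @regular_mod a (powers l) (n.+1 * (total l0).+1); apply.
- by move: sh; rewrite /= !size_map.
- by move=> x; apply: (@mem_powers l0 x) => y; apply: sI.
- apply: (subset_trans (pow_mul (p := (total l0).+1) iI (reduces_pow rs))).
  exact: (@pow_span_powers _ [set 0] l0 i0).
Qed.

(** Let Z be generated by the other generators. Then I^(n+j+1) is contained in
    a I^(n+j) + Z^(j+1) I^n by induction on j, and Z^(j+1) vanishes modulo their powers
    as soon as j is at least the total exponent. *)
Lemma reduces_modulo n a l : reduces n I (a :: unzip1 l) ->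
  exists M0, forall M, (M0 <= M)%N -> forall v, ideal_pow I M.+1 v ->
    exists2 w, ideal_pow I M w & ideal_span [set 0] (powers l) (v - a * w).
Proof.
move=> [sI rs]; pose Z := ideal_span [set 0] (unzip1 l).
have iZ : is_ideal Z by apply: span_ideal.
have Ia : I a by apply: sI; apply: mem_head.
have ZI : Z `<=` I.
  apply: span_min => // [_ ->|x xl]; first exact: ideal0.
  by apply: sI; rewrite inE xl orbT.
pose Y j := ideal_mul (ideal_pow Z j.+1) (ideal_pow I n).
have iY j : is_ideal (Y j) by apply: mul_ideal.
have YI j : Y j `<=` ideal_pow I (n + j.+1).
  apply: mul_min; first exact: pow_ideal.
  by move=> z y Zz Iy; rewrite addnC; apply: powM => //; apply: pow_mono Zz.
pose E j := [set v | exists2 w, ideal_pow I (n + j) w & Y j (v - a * w)].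
have iE j : is_ideal (E j).
  split=> [|v v' [w Iw Yw] [w' Iw' Yw']|c v [w Iw Yw]].
  - by exists 0; [apply: ideal0 (pow_ideal _ _)|rewrite mulr0 subrr; apply: ideal0].
  - exists (w + w'); first exact: idealD (pow_ideal _ _) Iw Iw'.
    by have := idealD (iY j) Yw Yw'; congr (Y j _); ring.
  - exists (c * w); first exact: ideal_mull (pow_ideal _ _) Iw.
    by have := ideal_mull c (iY j) Yw; congr (Y j _); ring.
have IE j : ideal_pow I (n + j).+1 `<=` E j.
  elim: j => [|j IH].
    rewrite addn0; apply: (subset_trans rs); apply: mul_min => // x y [c Zx] Iy.
    exists (c * y); first by rewrite addn0; apply: ideal_mull (pow_ideal _ _) Iy.
    have -> : x * y - a * (c * y) = (x - c * a) * y by ring.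
    by apply: mem_mul => //; rewrite pow1.
  rewrite addnS; apply: mul_min => // e v Ie /IH[w Iw Yw].
  suff [w' Iw' Yw'] : E j.+1 (e * (v - a * w)).
    exists (e * w + w'); last by congr (Y _ _): Yw'; ring.
    by apply: idealD (pow_ideal _ _) _ Iw'; rewrite addnS; apply: mem_mul.
  move: {w Iw}(v - a * w) Yw => u Yu; rewrite mulrC; move: u Yu.
  apply: (mul_min (ideal_preim e (iE j.+1))) => z y Zz Iy /=.
  have : ideal_pow I n.+1 (y * e) by rewrite mulrC; apply: mem_mul.
  rewrite -mulrA [z * _]mulrC => /rs; move: (y * e).
  apply: (mul_min (ideal_preim z (iE j.+1))) => x y' [c Zx] Iy' /=.
  exists (c * (y' * z)).
    by apply: ideal_mull (pow_ideal _ _) _; apply: powM => //; apply: pow_mono Zz.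
  have -> : x * y' * z - a * (c * (y' * z)) = ((x - c * a) * z) * y' by ring.
  by apply: mem_mul => //; apply: mem_mul.
exists (n + total l)%N => M nM v Iv.
have ME : M = (n + (M - n))%N by lia.
rewrite ME in Iv *; have [w Iw Yw] := IE _ _ Iv; exists w => //.
have lM : (total l <= M - n)%N by lia.
apply: (pow_span_powers (l := l) i0).
by apply: (pow_decr (n := (M - n).+1)) => //; apply: mul_subl Yw; apply: pow_ideal.
Qed.

Lemma reduces_modulo_exp n a l : reduces n I (a :: unzip1 l) ->
  exists M0, forall M p, (M0 <= M)%N -> forall v, ideal_pow I (M + p) v ->
    exists2 w, ideal_pow I M w & ideal_span [set 0] (powers l) (v - a ^+ p * w).
Proof.
move=> /reduces_modulo[M0 HM0]; exists M0 => M p MM.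
elim: p => [|p IH] v.
  rewrite addn0 => Iv; exists v => //; rewrite expr0 mul1r subrr.
  by apply: ideal0; apply: span_ideal.
rewrite addnS => /HM0[|w /IH[w' Iw' Qw'] Qv]; first by lia.
exists w' => //; have iQ := span_ideal (powers l) i0.
have := idealD iQ Qv (ideal_mull a iQ Qw'); congr (ideal_span _ _ _).
by rewrite exprS; ring.
Qed.

(** When the powers of the elements of s form regular sequences, [pow_cap] identifies this
    set with the intersection over all n of J^(n+1) : I^n, where J = (s). Giving each
    generator its own exponent allows them to be exchanged one at a time, and the
    permutation makes the order of s irrelevant. *)
Definition joint_colon s x := forall l v, perm_eq (unzip1 l) s ->
  ideal_pow I (total l) v -> ideal_span [set 0] (powers l) (x * v).

Lemma perm_joint_colon s s' x :
  perm_eq s s' -> joint_colon s x -> joint_colon s' x.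
Proof. by move=> ss' H l v ls'; apply: H; rewrite (permPr ss'). Qed.

Lemma joint_colon_span s x : joint_colon s x -> ideal_span [set 0] s x.
Proof.
pose l := [seq (a, 0%N) | a <- s] => /(_ l 1).
have -> : powers l = s by rewrite /powers -map_comp map_id_in.
rewrite mulr1; apply; first by rewrite /unzip1 -map_comp map_id_in.
by rewrite (_ : total l = 0%N) // /total /l /unzip2 -map_comp; elim: (s).
Qed.

Lemma unzip1_perm_cons a s l : perm_eq (unzip1 l) (a :: s) ->
  exists q l', perm_eq l ((a, q) :: l') /\ perm_eq (unzip1 l') s.
Proof.
move=> lE; have : a \in unzip1 l by rewrite (perm_mem lE) mem_head.
case/mapP=> -[a' q] pl /= aa'; rewrite -{}aa' in pl; have lp := perm_to_rem pl.
exists q, (rem (a, q) l); split=> //.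
by rewrite -(perm_cons a) -(permPr lE) perm_sym; apply: (perm_map fst lp).
Qed.

(** Exchange of one generator: modulo the powers Q of the common generators, a and b
    are regular and I^M = b^p I^(M-p) for large M. So a^M v = b^(q+1) z with z in
    I^(M-1+c), hence x z = a^M d, and cancelling a^M gives x v = b^(q+1) d. *)
Lemma joint_colon_exchange n n' a b s x : size (a :: s) = h ->
  reduces n I (a :: s) -> reduces n' I (b :: s) ->
  joint_colon (a :: s) x -> joint_colon (b :: s) x.
Proof.
move=> sh ra rb xa l v /unzip1_perm_cons[q [l' [ll' l's]]].
rewrite (perm_total ll') (perm_powers i0 ll') => Iv.
have al' : perm_eq (a :: unzip1 l') (a :: s) by rewrite perm_cons.
have bl' : perm_eq (b :: unzip1 l') (b :: s) by rewrite perm_cons.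
have ra' : reduces n I (a :: unzip1 l').
  by apply: eq_reduces_mem ra => z; rewrite (perm_mem al').
have rb' : reduces n' I (b :: unzip1 l').
  by apply: eq_reduces_mem rb => z; rewrite (perm_mem bl').
have na := reduces_nonzerodivisor ra' (etrans (perm_size al') sh).
have [M0 HM0] := reduces_modulo_exp rb'.
have Ia : I a by case: ra => + _; apply; apply: mem_head.
set Q := ideal_span [set 0] (powers l') in na HM0.
have iQ : is_ideal Q by apply: span_ideal.
pose c := total l'.
have Iav : ideal_pow I (M0 + c + q.+1) (a ^+ M0.+1 * v).
  have -> : (M0 + c + q.+1)%N = (M0.+1 + total ((b, q) :: l'))%N.
    by rewrite /total /= /c /total; lia.
  by apply: powM => //; apply: mem_pow.
have [z Iz Qz] := HM0 (M0 + c)%N q.+1 (leq_addr _ _) _ Iav.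
have [d Qd] : ideal_adj Q (a ^+ M0.+1) (x * z).
  by apply: (xa ((a, M0) :: l')).
exists d; apply: (nonzerodivisor_exp (n := M0.+1) na).
have := idealD iQ (ideal_mull x iQ Qz) (ideal_mull (b ^+ q.+1) iQ Qd).
by congr (Q _); rewrite /=; ring.
Qed.

Lemma joint_colon_path n s (l : seq (R * R)) x :
  size (s ++ unzip1 l) = h ->
  (forall j, (j <= size l)%N ->
     reduces n I (s ++ unzip2 (take j l) ++ unzip1 (drop j l))) ->
  joint_colon (s ++ unzip1 l) x -> joint_colon (s ++ unzip2 l) x.
Proof.
elim: l s => [//|[a b] l IH] s sh rl xa.
have sb : rcons s b ++ unzip2 l = s ++ unzip2 ((a, b) :: l) by rewrite cat_rcons.
rewrite -sb; apply: IH.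
- by rewrite -sh !size_cat size_rcons /= addSnnS.
- by move=> j jl; have := rl j.+1 jl; rewrite cat_rcons.
have perm c : perm_eq (s ++ c :: unzip1 l) (c :: s ++ unzip1 l).
  by rewrite perm_catC /= perm_cons perm_catC.
rewrite cat_rcons; apply: (perm_joint_colon (s := b :: s ++ unzip1 l)).
  by rewrite perm_sym.
apply: (@joint_colon_exchange n n a).
- by rewrite -(perm_size (perm a)).
- have := rl 0%N isT; rewrite take0 drop0; apply: eq_reduces_mem => z.
  by rewrite -(perm_mem (perm a)).
- have := rl 1%N isT; rewrite /= take0 drop0; apply: eq_reduces_mem => z.
  by rewrite -(perm_mem (perm b)).
- by apply: perm_joint_colon xa; apply: perm.
Qed.

End Comparison.

Section Independence.
Variables (R : comNzRingType) (m : set R) (k : fieldType) (pi : {rmorphism R -> k}).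
Hypotheses (nR : noetherian R) (m_unit : forall u, ~ m u -> exists v, u * v = 1).
Hypotheses (pi_m : forall x, pi x = 0 <-> m x) (k_char0 : [pchar k] =i pred0).
Variables (I : set R) (h : nat).
Hypotheses (iI : is_ideal I).
Hypothesis regular_mod : forall a s n, size (a :: s) = h ->
  (forall x, x \in a :: s -> I x) ->
  ideal_pow I n `<=` ideal_span [set 0] (a :: s) ->
  nonzerodivisor (ideal_span [set 0] s) a.
Implicit Types (a b c u v w x y z : R) (s : seq R) (t n r : nat).

Let i0 := @ideal_set0 R.

(** For n >= r the inclusion x I^n <= J^(n+1) follows from I^n = J^(n-r) I^r; smaller total
    exponents are reached by cancelling a power of a generator. *)
Lemma colon_joint a s r x : size (a :: s) = h -> reduces r I (a :: s) ->
  ideal_colon (ideal_pow (ideal_span [set 0] (a :: s)) r.+1) (ideal_pow I r) x ->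
  joint_colon I (a :: s) x.
Proof.
set J := ideal_span _ (a :: s) => sh rs xr.
have xN j : ideal_pow I (r + j) `<=` [set v | ideal_pow J (r + j).+1 (v * x)].
  elim: j => [|j IH]; first by move=> v; rewrite addn0 /= mulrC; apply: xr.
  have [_ rj] := reduces_ge iI (leq_addr j r) rs.
  rewrite addnS; apply: (subset_trans rj).
  apply: mul_min; first exact: (ideal_preim x (pow_ideal _ _)).
  by move=> b v Jb /IH Jv /=; rewrite -mulrA; apply: mem_mul.
move=> l v /unzip1_perm_cons[q [l' [ll' l's]]].
rewrite (perm_total ll') (perm_powers i0 ll') => Iv.
have al' : perm_eq (a :: unzip1 l') (a :: s) by rewrite perm_cons.
have rs' : reduces r I (a :: unzip1 l').
  by apply: eq_reduces_mem rs => z; rewrite (perm_mem al').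
have na := reduces_nonzerodivisor iI regular_mod rs' (etrans (perm_size al') sh).
pose d := total ((a, q) :: l').
have Ia : I a by case: rs => + _; apply; apply: mem_head.
have : ideal_pow J (r + d).+1 ((a ^+ r * v) * x).
  by apply: xN; apply: powM => //; apply: mem_pow.
have -> : J = ideal_span [set 0] (unzip1 ((a, (r + q)%N) :: l')).
  by apply: eq_span_mem => // z; rewrite -(perm_mem al').
have -> : (r + d)%N = total ((a, (r + q)%N) :: l') by rewrite /d /total /= addnA.
move/(pow_span_powers i0) => /= [c Qc]; exists c; apply: (nonzerodivisor_exp (n := r) na).
by congr (ideal_span _ _ _): Qc; rewrite -addnS exprD; ring.
Qed.

(** For two reductions (a_i), (b_i) and large t, all mixtures of (a_i) with
    c_i = a_i + t (b_i - a_i), and of (c_i) with (b_i), are reductions, so that one can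
    pass from (a_i) to (b_i) exchanging one generator at a time. *)
Lemma joint_colon_indep n (l : seq (R * R)) x : size l = h ->
  reduces n I (unzip1 l) -> reduces n I (unzip2 l) ->
  joint_colon I (unzip1 l) x -> joint_colon I (unzip2 l) x.
Proof.
move=> lh ra rb xa.
pose c t := [seq p.1 + t.+1%:R * (p.2 - p.1) | p <- l].
have Il p : p \in l -> I (p.2 - p.1).
  move=> pl; apply: (idealB iI).
    by case: rb => + _; apply; apply: map_f.
  by case: ra => + _; apply; apply: map_f.
have ev0 j : eventually (fun t => reduces n I (take j (c t) ++ unzip1 (drop j l))).
  pose g i := [seq (p.1, p.2 - p.1) | p <- take i l] ++ [seq (p.1, 0) | p <- drop i l].
  have [||T HT] := eventually_reduces (l := g j) nR m_unit pi_m k_char0 iI (n := n).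
  - by rewrite /unzip1 map_cat -!map_comp -map_cat cat_take_drop.
  - move=> p; rewrite mem_cat => /orP[] /mapP[p' p'l ->] /=; last exact: ideal0.
    by apply: Il; apply: mem_take p'l.
  exists T => t Tt; have := HT t.+1 (leqW Tt); rewrite map_cat -!map_comp -map_take.
  congr (reduces n I (_ ++ _)); apply: eq_map => p /=.
  by rewrite mulr0 addr0.
have ev1 j : eventually (fun t => reduces n I (unzip2 (take j l) ++ drop j (c t))).
  pose g i := [seq (p.2, 0) | p <- take i l] ++ [seq (p.2, p.2 - p.1) | p <- drop i l].
  have [||T HT] := eventually_reduces (l := g j) nR m_unit pi_m k_char0 iI (n := n).
  - by rewrite /unzip1 map_cat -!map_comp -map_cat cat_take_drop.
  - move=> p; rewrite mem_cat => /orP[] /mapP[p' p'l ->] /=; first exact: ideal0.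
    by apply: Il; apply: mem_drop p'l.
  exists T => t Tt; have := HT t Tt; rewrite map_cat -!map_comp -map_drop.
  congr (reduces n I (_ ++ _)); apply: eq_map => p /=.
    by rewrite mulr0 addr0.
  by rewrite -natr1; ring.
have [T HT] := eventually_and (eventually_all (s := iota 0 h.+1) (fun j _ => ev0 j))
  (eventually_all (s := iota 0 h.+1) (fun j _ => ev1 j)).
have [H0 H1] := HT T (leqnn _).
have sc : size (c T) = size l by rewrite size_map.
have xc : joint_colon I (c T) x.
  pose l1 := zip (unzip1 l) (c T).
  have l11 : unzip1 l1 = unzip1 l by rewrite unzip1_zip // !size_map.
  have l12 : unzip2 l1 = c T by rewrite unzip2_zip // !size_map.
  rewrite -l12; apply: (@joint_colon_path _ _ h iI regular_mod n [::]).
  - by rewrite /= l11 size_map.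
  - move=> j; rewrite size_zip !size_map minnn lh => jh /=.
    rewrite /unzip2 map_take -/(unzip2 l1) l12 /unzip1 map_drop -/(unzip1 l1) l11 -map_drop.
    by apply: H0; rewrite mem_iota.
  - by rewrite /= l11.
pose l2 := zip (c T) (unzip2 l).
have l21 : unzip1 l2 = c T by rewrite unzip1_zip // !size_map.
have l22 : unzip2 l2 = unzip2 l by rewrite unzip2_zip // !size_map.
rewrite -l22; apply: (@joint_colon_path _ _ h iI regular_mod n [::]).
- by rewrite /= l21 sc.
- move=> j; rewrite size_zip !size_map minnn lh => jh /=.
  rewrite /unzip2 map_take -/(unzip2 l2) l22 /unzip1 map_drop -/(unzip1 l2) l21 -map_take.
  by apply: H1; rewrite mem_iota.
- by rewrite /= l21.
Qed.

End Independence.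

(** * Intersecting the ideals (a + t b) *)

Section Forms.
Variables (R : comNzRingType) (Q : set R) (a b : R).
Hypotheses (iQ : is_ideal Q) (nat_unit : forall n, exists v, n.+1%:R * v = 1 :> R).
Implicit Types (c d f g v w x y z : R) (t u n : nat) (ts : seq nat).

(** The values at (a, b) of the binary forms of degree n. *)
Let F n := ideal_pow (ideal_span [set 0] [:: a; b]) n.
Let alpha t := a + t%:R * b.
Let i0 := @ideal_set0 R.

Let iF n : is_ideal (F n). Proof. exact: pow_ideal. Qed.

Let Fa : ideal_span [set 0] [:: a; b] a.
Proof. by apply: (mem_span i0); rewrite mem_head. Qed.

Let Fb : ideal_span [set 0] [:: a; b] b.
Proof. by apply: (mem_span i0); rewrite !inE eqxx orbT. Qed.

Lemma alpha_form t n f : F n f -> F n.+1 (alpha t * f).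
Proof.
move=> Ff; apply: mem_mul => //; apply: (idealD (span_ideal _ i0)) => //.
exact: (ideal_mull _ (span_ideal _ i0)).
Qed.

Lemma prod_form ts : F (size ts) (\prod_(u <- ts) alpha u).
Proof.
by elim: ts => [//|u ts IH]; rewrite big_cons; apply: alpha_form.
Qed.

(** A binary form is determined modulo a + t b by its coefficient at the pure power of b. *)
Lemma form_split t n z : F n.+1 z ->
  exists f d, F n f /\ z = alpha t * f + d * b ^+ n.+1.
Proof.
have split1 p w : F p.+1 w -> exists f g, [/\ F p f, F p g & w = alpha t * f + b * g].
  pose E := [set v | exists f g, [/\ F p f, F p g & v = alpha t * f + b * g]].
  have iE : is_ideal E.
    split=> [|x y [f [g [Ff Fg ->]]] [f' [g' [Ff' Fg' ->]]]|c x [f [g [Ff Fg ->]]]].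
    - by exists 0, 0; split; do ?[exact: ideal0]; ring.
    - exists (f + f'), (g + g'); split; do ?[exact: (idealD (iF p))]; ring.
    - exists (c * f), (c * g); split; do ?[exact: (ideal_mull c (iF p))]; ring.
  apply: (mul_min iE) => x y [c [d dE]] Fy.
  exists (c * y), ((d - c * t%:R) * y); split; do ?[exact: (ideal_mull _ (iF p))].
  have -> : x = c * a + d * b by move: dE => /= /eqP; rewrite subr_eq0 => /eqP <-; ring.
  by rewrite /alpha; ring.
elim: n z => [|n IH] z /split1[f [g [Ff Fg ->]]].
  by exists f, g; split=> //; ring.
have [f' [d [Ff' ->]]] := IH g Fg.
exists (f + b * f'), d; split; last by rewrite [b ^+ n.+2]exprS; ring.
by apply: (idealD (iF _)) => //; apply: mem_mul.
Qed.

Lemma nat_sub_unit t u : t != u -> exists v, (t%:R - u%:R) * v = 1 :> R.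
Proof.
wlog tu : t u / (u < t)%N => [H|_].
  rewrite neq_ltn => /orP[ut|tu]; last by apply: H => //; rewrite gtn_eqF.
  have [||v uv] := H u t => //; first by rewrite gtn_eqF.
  by exists (- v); rewrite mulrN -mulNr opprB.
by have [v] := nat_unit (t - u.+1); rewrite subnSK // natrB 1?ltnW //; exists v.
Qed.

(** Modulo a + t b each factor a + u b is the unit u - t times b. *)
Lemma prod_alpha t ts : ts != [::] -> t \notin ts ->
  exists f v, F (size ts).-1 f /\
    b ^+ size ts = v * \prod_(u <- ts) alpha u - alpha t * f.
Proof.
case: ts => [//|u ts _]; elim: ts u => [|u' ts IH] u.
  rewrite inE eq_sym => /nat_sub_unit[v uv].
  by exists v, v; split=> //=; rewrite big_seq1 expr1 -[LHS]mul1r -uv /alpha; ring.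
rewrite inE negb_or eq_sym => /andP[/nat_sub_unit[v uv] tts].
have [f [w [Ff bE]]] := IH u' tts; rewrite /= in Ff.
set P := \prod_(u <- u' :: ts) alpha u in bE.
exists (b * f + v * w * P), (v * w); split.
  apply: (idealD (iF _)); first exact: mem_mul.
  by apply: (ideal_mull _ (iF _)); apply: (prod_form (u' :: ts)).
have -> : \prod_(u <- [:: u, u' & ts]) alpha u = alpha u * P by rewrite big_cons.
have -> : b ^+ size [:: u, u' & ts] = (u%:R - t%:R) * v * b * (w * P - alpha t * f).
  by rewrite uv mul1r -bE -exprS.
have -> : (u%:R - t%:R) * v * b * (w * P - alpha t * f)
  = (u%:R - t%:R) * v * b * w * P - (u%:R - t%:R) * v * b * (alpha t * f) by ring.
rewrite [in X in _ - X]uv mul1r /alpha; ring.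
Qed.

(** Partial fractions without denominators, by induction on the number of factors: a
    form is a multiple of a + t b plus a multiple of a pure power of b, and the latter
    is expressed by [prod_alpha] through the product over the other integers. *)
Lemma mul_form_prod ts y f : ts != [::] -> uniq ts ->
  (forall t, t \in ts -> ideal_adj Q (alpha t) y) -> F (size ts).-1 f ->
  ideal_adj Q (\prod_(t <- ts) alpha t) (y * f).
Proof.
case: ts => [//|t ts _]; elim: ts t f => [|t' ts IH] t f.
  move=> _ yt _; rewrite big_seq1 mulrC.
  by apply: (ideal_mull _ (adj_ideal _ iQ)); apply: yt; rewrite mem_head.
move=> /andP[tts uts] yt Ff.
have [d Qd] := yt t (mem_head _ _).
have yts u : u \in t' :: ts -> ideal_adj Q (alpha u) y.
  by move=> uts'; apply: yt; rewrite inE uts' orbT.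
have [f1 [d1 [Ff1 ->]]] := form_split t Ff.
have [f2 [v [Ff2 ->]]] := prod_alpha (isT : t' :: ts != [::]) tts.
rewrite big_cons; set P := \prod_(u <- _ :: _) _.
have iP := adj_ideal (alpha t * P) iQ.
have [c1 Qc1] := IH t' f1 uts yts Ff1; have [c2 Qc2] := IH t' f2 uts yts Ff2.
rewrite -/P in Qc1 Qc2.
exists (c1 - d1 * c2 + d1 * v * d).
have := idealD iQ (ideal_mull (d1 * v * P) iQ Qd)
  (idealB iQ (ideal_mull (alpha t) iQ Qc1) (ideal_mull (d1 * alpha t) iQ Qc2)).
by congr (Q _); ring.
Qed.

(** In the fractions over R/Q, with u = b/a and P the product of the factors 1 + t u, the
    element y/a maps R[u] into P R by [mul_form_prod], and hence into R, as P maps R[u] to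
    itself. The integrality relation for b bounds the degrees of the forms needed to
    generate R[u]. *)
Lemma mul_pow_mem y n k0 f0 ts : F k0 f0 -> Q (b ^+ k0.+1 - a * f0) ->
  uniq ts -> size ts = k0.+1 -> (forall t, t \in ts -> nonzerodivisor Q (alpha t)) ->
  (forall t, t \in ts -> ideal_adj Q (alpha t) y) ->
  ideal_adj Q (a ^+ n.+1) (y * b ^+ n).
Proof.
move=> Ff0 Qb uts sts nts yts.
have a0 : alpha 0 = a by rewrite /alpha mul0r addr0.
have step j z : (k0 <= j)%N -> F j.+1 z -> exists2 f, F j f & Q (z - a * f).
  move=> kj /(form_split 0)[f [d [Ff ->]]]; rewrite a0.
  exists (f + d * b ^+ (j - k0) * f0).
    apply: (idealD (iF _)) => //; rewrite -mulrA; apply: (ideal_mull _ (iF _)).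
    by rewrite -{1}(subnK kj); apply: powM => //; apply: mem_pow.
  have := ideal_mull (d * b ^+ (j - k0)) iQ Qb; congr (Q _).
  have -> : b ^+ j.+1 = b ^+ (j - k0) * b ^+ k0.+1 by rewrite -exprD addnS subnK.
  by ring.
have steps p z : F (p + k0) z -> exists2 f, F k0 f & Q (z - a ^+ p * f).
  elim: p z => [|p IH] z Fz.
    by exists z => //; rewrite mul1r subrr; apply: ideal0.
  have [w /IH[f Ff Qf] Qw] := step _ _ (leq_addl p k0) Fz; exists f => //.
  have := idealD iQ Qw (ideal_mull a iQ Qf); congr (Q _).
  by rewrite exprS; ring.
pose P := \prod_(t <- ts) alpha t.
have nP : nonzerodivisor Q P.
  move: nts; rewrite /P; elim: (ts) => [|t ts' IH] nts z; first by rewrite big_nil mul1r.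
  rewrite big_cons -mulrA => /(nts t (mem_head _ _)); apply: IH => u uts'.
  by apply: nts; rewrite inE uts' orbT.
have [f Ff Qf] : exists2 f, F k0 f & Q (P * b ^+ n - a ^+ n.+1 * f).
  apply: steps; have -> : (n.+1 + k0)%N = (size ts + n)%N by rewrite sts; lia.
  by apply: powM; [exact: prod_form|exact: mem_pow].
have [||d Qd] := mul_form_prod (ts := ts) (y := y) (f := f) _ uts yts.
- by rewrite -size_eq0 sts.
- by rewrite sts.
exists d; apply: nP.
have := idealD iQ (ideal_mull y iQ Qf) (ideal_mull (a ^+ n.+1) iQ Qd).
by rewrite -/P; congr (Q _); ring.
Qed.

End Forms.

(** * Multiplying elements of the core by powers *)

Section CoreSubset.
Variables (R : comNzRingType) (m : set R) (k : fieldType) (pi : {rmorphism R -> k}).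
Hypotheses (nR : noetherian R) (m_unit : forall u, ~ m u -> exists v, u * v = 1).
Hypotheses (pi_m : forall x, pi x = 0 <-> m x) (k_char0 : [pchar k] =i pred0).
Hypothesis nat_unit : forall n, exists v, n.+1%:R * v = 1 :> R.
Variables (I : set R) (h : nat).
Hypotheses (iI : is_ideal I).
Hypothesis regular_mod : forall a s n, size (a :: s) = h ->
  (forall x, x \in a :: s -> I x) ->
  ideal_pow I n `<=` ideal_span [set 0] (a :: s) ->
  nonzerodivisor (ideal_span [set 0] s) a.
Implicit Types (a b c u v w x y z : R) (s : seq R) (t n r : nat).
Implicit Types (l : seq (R * nat)).

Let i0 := @ideal_set0 R.

(** If I^(M+j) = a^j I^M modulo Q for all j, write a^M b^j = a^j v_j: since the ideal
    generated by all v_j is finitely generated, b is integral over (a) modulo Q. *)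
Lemma integral_mod (Q : set R) a b M : is_ideal Q -> I a -> I b -> nonzerodivisor Q a ->
  (forall p v, ideal_pow I (M + p) v ->
     exists2 w, ideal_pow I M w & Q (v - a ^+ p * w)) ->
  exists d f, ideal_pow (ideal_span [set 0] [:: a; b]) d f /\ Q (b ^+ d.+1 - a * f).
Proof.
move=> iQ Ia Ib na IM; set F := ideal_pow _.
have iF n : is_ideal (F n) by apply: pow_ideal.
have Fa : ideal_span [set 0] [:: a; b] a by apply: (mem_span i0); rewrite mem_head.
have Fb : ideal_span [set 0] [:: a; b] b.
  by apply: (mem_span i0); rewrite !inE eqxx orbT.
have /choice[v vQ] j : exists w, Q (a ^+ M * b ^+ j - a ^+ j * w).
  have [|w _ Qw] := IM j (a ^+ M * b ^+ j); last by exists w.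
  by apply: powM; apply: mem_pow.
have [K vK] := noetherian_seq nR v iQ; exists K.
pose W := [set x | exists f, F K f /\ Q (b * a ^+ K * x - a ^+ M * (a * f))].
have iW : is_ideal W.
  split=> [|x y [f [Ff Qf]] [g [Fg Qg]]|c x [f [Ff Qf]]].
  - by exists 0; split; [apply: (ideal0 (iF K))|rewrite !mulr0 subrr; apply: ideal0].
  - exists (f + g); split; first exact: (idealD (iF K)).
    by have := idealD iQ Qf Qg; congr (Q _); ring.
  - exists (c * f); split; first exact: (ideal_mull c (iF K)).
    by have := ideal_mull c iQ Qf; congr (Q _); ring.
have [f [Ff Qf]] : W (v K).
  apply: (span_min iW _ _ vK) => [x Qx|y /mapP[j]].
    exists 0; split; first exact: (ideal0 (iF K)).
    by rewrite !mulr0 subr0; apply: ideal_mull.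
  rewrite mem_iota => /andP[_ jK] ->; exists (a ^+ (K - j.+1) * b ^+ j.+1); split.
    have {1}-> : K = (K - j.+1 + j.+1)%N by lia.
    by apply: powM; apply: mem_pow.
  have := idealN iQ (ideal_mull (b * a ^+ (K - j.+1) * a) iQ (vQ j)); congr (Q _).
  have -> : a ^+ K = a ^+ (K - j.+1) * a * a ^+ j by rewrite -exprSr -exprD; congr (_ ^+ _); lia.
  by rewrite [b ^+ j.+1]exprS; ring.
exists f; split=> //; apply: (nonzerodivisor_exp (n := M) na).
by have := idealD iQ (ideal_mull b iQ (vQ K)) Qf; congr (Q _); rewrite exprS; ring.
Qed.

(** The elements of the core, multiplied by powers of b, are tested against the
    generators (a, q) :: l one at a time: the reductions obtained from a by adding
    t b, for large t, are intersected by [mul_pow_mem]. *)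
Lemma core_mul_pow n x b l s : size (s ++ unzip1 l) = h ->
  reduces n I (s ++ unzip1 l) -> core I x -> I b ->
  ideal_span [set 0] (s ++ powers l) (x * b ^+ total l).
Proof.
move=> + + xcore Ib; elim: l s => [|[a q] l IH] s sh rs.
  rewrite cats0 in rs *; apply: (ideal_mulr _ (span_ideal _ i0)).
  by apply: xcore; apply: reduces_is_reduction rs.
pose l' := [seq (c, 0%N) | c <- s] ++ l.
have l'1 : unzip1 l' = s ++ unzip1 l.
  by rewrite /unzip1 map_cat -map_comp map_id_in.
have l'2 : powers l' = s ++ powers l.
  by rewrite /powers map_cat -map_comp map_id_in.
have mid c : s ++ c :: unzip1 l =i c :: unzip1 l'.
  by move=> z; rewrite l'1 !(mem_cat, inE) orbCA.
have sz c : size (c :: unzip1 l') = h by rewrite l'1 -sh /= !size_cat /= addnS.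
set Q := ideal_span [set 0] (powers l').
have iQ : is_ideal Q by apply: span_ideal.
have ra : reduces n I (a :: unzip1 l') by apply: eq_reduces_mem rs; apply: mid.
have Ia : I a by case: ra => + _; apply; apply: mem_head.
have na := reduces_nonzerodivisor iI regular_mod ra (sz a).
have [M0 HM0] := reduces_modulo_exp iI ra.
have [d [f [Ff Qf]]] := integral_mod iQ Ia Ib na (fun p => HM0 M0 p (leqnn _)).
pose g := (a, b) :: [seq (c, 0) | c <- unzip1 l'].
have [||T HT] := eventually_reduces (l := g) nR m_unit pi_m k_char0 iI (n := n).
- by rewrite /g /unzip1 /= -map_comp map_id_in.
- by move=> p; rewrite inE => /orP[/eqP->//|/mapP[c _ ->]]; apply: ideal0.
have rt t : (T <= t)%N -> reduces n I (a + t%:R * b :: unzip1 l').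
  move=> /HT; rewrite /g /= -map_comp; congr (reduces n I (_ :: _)).
  by apply: map_id_in => c _ /=; rewrite mulr0 addr0.
have : ideal_adj Q (a ^+ q.+1) (x * b ^+ total l * b ^+ q).
  apply: (@mul_pow_mem _ Q a b iQ nat_unit _ q d f (iota T d.+1)) => //.
  - exact: iota_uniq.
  - exact: size_iota.
  - move=> t; rewrite mem_iota => /andP[Tt _].
    by apply: (reduces_nonzerodivisor iI regular_mod (rt t Tt) (sz _)).
  - move=> t; rewrite mem_iota => /andP[Tt _]; set c := a + _.
    have := IH (rcons s c); rewrite !cat_rcons => H.
    have : ideal_span [set 0] (s ++ c :: powers l) (x * b ^+ total l).
      apply: H; first by rewrite -sh !size_cat.
      by apply: eq_reduces_mem (rt t Tt) => z; rewrite mid.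
    rewrite (_ : ideal_span _ _ = ideal_adj Q c) //.
    have -> : ideal_adj Q c = ideal_span [set 0] (c :: powers l') by [].
    by apply: eq_span_mem => // z; rewrite l'2 !(mem_cat, inE) orbCA.
rewrite -mulrA -exprD addnC.
have -> : (q + total l)%N = total ((a, q) :: l) by [].
have -> : ideal_adj Q (a ^+ q.+1) = ideal_span [set 0] (a ^+ q.+1 :: powers l') by [].
rewrite (_ : ideal_span _ (a ^+ q.+1 :: _) =
  ideal_span [set 0] (s ++ powers ((a, q) :: l))) //.
by apply: eq_span_mem => // z; rewrite l'2 !(mem_cat, inE) orbCA.
Qed.

(** A Vandermonde argument: divide f - f(T) by X - T and use that t - T is a unit. *)
Lemma poly_coef_mem (B : set R) (f : {poly R}) : is_ideal B ->
  eventually (fun t => B f.[t%:R]) -> forall i, B f`_i.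
Proof.
move=> iB; elim: {f}(size f) {-2}f (leqnn (size f)) => [|n IH] f.
  by rewrite leqn0 size_poly_eq0 => /eqP-> _ i; rewrite coef0; apply: ideal0.
move=> fn [T fT].
have /factor_theorem[g gE] : root (f - f.[T%:R]%:P) T%:R.
  by rewrite /root !hornerE subrr.
have fE : f = g * ('X - T%:R%:P) + f.[T%:R]%:P by rewrite -gE subrK.
have gn : (size g <= n)%N.
  have [->|g0] := eqVneq g 0; first by rewrite size_poly0.
  have : (size (g * ('X - T%:R%:P))%R <= n.+1)%N.
    rewrite -gE; apply: leq_trans (size_polyD _ _) _; rewrite geq_max fn size_polyN.
    by apply: leq_trans (size_polyC_leq1 _) _.
  by rewrite size_Mmonic ?monicXsubC // size_XsubC addn2.
have gB : forall i, B g`_i.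
  apply: IH => //; exists T.+1 => t Tt.
  have [v tv] := nat_unit (t - T.+1); rewrite subnSK // natrB 1?ltnW // in tv.
  have := idealB iB (fT t (ltnW Tt)) (fT T (leqnn _)); rewrite {1}fE !hornerE addrK.
  move/(ideal_mull v iB); congr (B _); rewrite mulrCA [v * _]mulrC tv mulr1 //.
move=> i; rewrite fE coefD coefC mulrBr coefB coefMX coefMC.
apply: (idealD iB); last by case: eqP => // _; [exact: fT|exact: ideal0].
apply: (idealB iB); last exact: ideal_mulr.
by case: eqP => // _; apply: ideal0.
Qed.

(** Polarization: in characteristic 0 the power I^n is generated by the n-th powers of
    the members of I; the linear coefficient in t of (b + t e)^(p+1) is
    (p + 1) b^p e. *)
Lemma pow_subset_powers (B : set R) n : is_ideal B ->
  (forall b, I b -> B (b ^+ n)) -> ideal_pow I n `<=` B.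
Proof.
move=> iB IB.
suff H p q : (p + q)%N = n -> forall c b, ideal_pow I q c -> I b -> B (b ^+ p * c).
  by move=> c Ic; rewrite -(mul1r c) -(expr0 0); apply: (H 0%N n) => //; exact: ideal0.
elim: q p => [|q IH] p pq c b.
  by move=> _ Ib; apply: (ideal_mulr _ iB); move: pq; rewrite addn0 => ->; apply: IB.
move=> Ic Ib; move: c Ic; under eq_forall do rewrite mulrC.
apply: (mul_min (ideal_preim (b ^+ p) iB)) => e c Ie Ic /=.
pose f : {poly R} := (b%:P + e *: 'X) ^+ p.+1 * c%:P.
have fB : forall i, B f`_i.
  apply: poly_coef_mem => //; exists 0%N => t _.
  rewrite /f hornerM horner_exp !hornerE; apply: IH => //; first by rewrite addSnnS.
  by apply: (idealD iI) => //; apply: (ideal_mulr _ iI).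
have : B (f^`()).[0] by rewrite horner_coef0 coef_deriv; apply: fB.
have [v pv] := nat_unit p.
rewrite /f derivM derivC mulr0 addr0 deriv_exp derivD derivC derivZ derivX add0r.
rewrite hornerM hornerMn hornerM horner_exp !hornerE /= -mulr_natr => Bf.
have -> : e * c * b ^+ p = v * (e * b ^+ p * p.+1%:R * c).
  by rewrite -[LHS]mul1r -[X in X * _]pv; ring.
exact: ideal_mull.
Qed.

End CoreSubset.

(** * Parameters in Cohen-Macaulay local rings *)

(** A nonunit generates a proper ideal, which lies in a maximal one by Noetherian induction. *)
Lemma local_unit (R : comNzRingType) (m : set R) : noetherian R -> is_local m ->
  forall u, ~ m u -> exists v, u * v = 1.
Proof.
move=> nR [_ m_uniq] u nmu; apply: contrapT => nu; apply: nmu.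
have max_ex (A : set R) : is_ideal A -> ~ A 1 -> exists2 M, is_maximal M & A `<=` M.
  move: A; apply: (noetherian_ind nR) => A iA IH nA1.
  have [[B [iB nB1 AB]]|nB] := pselect (exists B, [/\ is_ideal B, ~ B 1 & A `<` B]).
    have [M mM BM] := IH B iB AB nB1; exists M => //.
    by apply: subset_trans BM; case: AB.
  exists A => //; split=> // B iB nB1 AB; apply: contrapT => BA; apply: nB.
  exists B; split=> //; split=> // BA'; apply: BA; exact/seteqP.
have iu := adj_ideal u (@ideal_set0 R).
have [[c /= /eqP]|M /m_uniq-> uM] := max_ex _ iu.
  by rewrite subr_eq0 => /eqP cu; apply: nu; exists c; rewrite mulrC -cu.
by apply: uM; apply: mem_adj; apply: ideal_set0.
Qed.

Lemma residue_nat_unit (R : comNzRingType) (m : set R) (k : fieldType)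
    (pi : {rmorphism R -> k}) :
  (forall u, ~ m u -> exists v, u * v = 1) -> (forall x, pi x = 0 <-> m x) ->
  [pchar k] =i pred0 -> forall n, exists v, n.+1%:R * v = 1 :> R.
Proof.
move=> m_unit pi_m /pcharf0P k0 n; apply: m_unit => /pi_m /eqP.
by rewrite rmorph_nat k0.
Qed.

Lemma prime_pow_mem (R : comNzRingType) (P I : set R) n :
  is_prime P -> ideal_pow I n `<=` P -> I `<=` P.
Proof.
move=> [iP nP1 Pmul] IP x Ix; have : P (x ^+ n) by apply: IP; apply: mem_pow.
elim: n {IP} => [|n IH]; first by rewrite expr0.
by rewrite exprS => /Pmul[].
Qed.

(** Every prime containing (s) contains I, so [grade_height] provides a regular sequence of
    length h in (s). *)
Lemma parameters_regular (R : comNzRingType) (m I : set R) (h n : nat) (s : seq R) :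
  cohen_macaulay_local m -> (forall n, exists v, n.+1%:R * v = 1 :> R) ->
  I `<=` m -> ideal_height I h -> size s = h -> (forall x, x \in s -> I x) ->
  ideal_pow I n `<=` ideal_span [set 0] s -> regular [set 0] s.
Proof.
move=> [nR lm [d [dimR depR]]] nat_unit Im [_ hI] sh sI Is.
have [[im m1 _] _] := lm; have m_unit := local_unit nR lm.
have i0 := @ideal_set0 R; have sm x : x \in s -> m x by move/sI/Im.
have zm : [set 0] `<=` m by move=> _ ->; apply: ideal0.
have iB := span_ideal s i0; have Bm : ideal_span [set 0] s `<=` m by apply: span_min.
have [|s' [ss' s'B rs']] := grade_height (h := h) nR im m1 m_unit nat_unit dimR depR iB Bm.
  move=> Q q pQ BQ; apply: hI => //.
  by apply: (prime_pow_mem (n := n) pQ); apply: subset_trans Is BQ.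
apply: (regular_of_grade nR im m1 m_unit nat_unit i0 zm sm).
by exists s'; rewrite ss' sh.
Qed.

Lemma ideal_height_uniq (R : comNzRingType) (I : set R) h h' :
  ideal_height I h -> ideal_height I h' -> h = h'.
Proof.
move=> [[Q [pQ IQ hQ]] min_h] [[Q' [pQ' IQ' hQ']] min_h'].
by apply/eqP; rewrite eqn_leq (min_h _ _ pQ' IQ' hQ') (min_h' _ _ pQ IQ hQ).
Qed.

(** * The core of an equimultiple ideal *)

Theorem theorem3p7 (R : comNzRingType) (m : set R)
    (k : fieldType) (pi : {rmorphism R -> k})
    (R_CM : cohen_macaulay_local m)
    (k_residue : is_residue_field m pi)
    (k_char0 : [pchar k]%R =i pred0)
    (I J : set R) (h r : nat)
    (I_ideal : is_ideal I)
    (I_equimultiple : equimultiple I)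
    (I_height : ideal_height I h)
    (h_ge1 : (1 <= h)%N)
    (J_minred : is_minimal_reduction I J)
    (J_rednum : reduction_number I J r) :
  core I = ideal_colon (ideal_pow J r.+1) (ideal_pow I r).
Proof.
have [nR lm _] := R_CM; have [[im m1 _] _] := lm.
have m_unit := local_unit nR lm; have [_ pi_m] := k_residue.
have nat_unit := residue_nat_unit m_unit pi_m k_char0.
have i0 := @ideal_set0 R.
have Im : I `<=` m.
  have [[Q [[iQ nQ1 _] IQ _]] _] := I_height; move=> x Ix; apply: contrapT.
  by move=> /m_unit[v xv]; apply: nQ1; rewrite -xv; apply: ideal_mulr (IQ _ Ix).
have regI n s := @parameters_regular R m I h n s R_CM nat_unit Im I_height.
have regular_mod a s n : size (a :: s) = h -> (forall x, x \in a :: s -> I x) ->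
    ideal_pow I n `<=` ideal_span [set 0] (a :: s) ->
    nonzerodivisor (ideal_span [set 0] s) a.
  move=> sh sI Is; have := regI n _ sh sI Is.
  have sm x : x \in a :: s -> m x by move/sI/Im.
  case/(regular_last nR im m1 m_unit i0 (sm a (mem_head _ _))) => // x xs.
  by apply: sm; rewrite inE xs orbT.
have minimal_gen K : is_minimal_reduction I K ->
    exists s, [/\ size s = h, K = ideal_span [set 0] s & forall x, x \in s -> I x].
  move=> mK; have [h' [I_height' /(_ _ mK)[s Ks]]] := I_equimultiple.
  have [[_ KI _] _] := mK.
  exists s; rewrite size_tuple -ideal_gen_seq (ideal_height_uniq I_height I_height').
  by split=> // x xs; apply: KI; rewrite Ks; apply: sub_ideal_gen.
have [sJ [sh JE sI]] := minimal_gen J J_minred.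
have [JI _] := J_rednum.
have rJ : reduces r I sJ by split=> //; rewrite -JE JI.
case: sJ => [|a s] in sh JE sI rJ *; first by move: h_ge1; rewrite -sh.
apply/seteqP; split=> x.
- move=> xcore v Iv; rewrite mulrC.
  apply: (@pow_subset_powers R nat_unit I I_ideal
            [set w | ideal_pow J r.+1 (w * x)] r _ _ v Iv).
    exact: (ideal_preim x (pow_ideal _ _)).
  move=> b Ib /=; rewrite mulrC.
  have [|||y Jy /= /eqP] := @pow_cap R m [set 0] a s r (x * b ^+ r) nR im m1 m_unit i0.
  + by move=> y /sI/Im.
  + move=> l lE.
    apply: (regI (r.+1 * (total l).+1)%N).
    * by rewrite size_map -sh -lE size_map.
    * by move=> y; apply: (mem_powers I_ideal); rewrite lE.
    * apply: (subset_trans (pow_mul (p := (total l).+1) I_ideal (reduces_pow rJ))).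
      by rewrite -lE; apply: pow_span_powers.
  + move=> l lE lr; rewrite -lr.
    have := @core_mul_pow R m k pi nR m_unit pi_m k_char0 nat_unit I h I_ideal regular_mod
      r x b l [::].
    by rewrite /= lE; apply.
  + by rewrite subr_eq0 => /eqP ->; rewrite JE.
- move=> xJ K /= redK.
  have [L minL LK] := minimal_reduction_ex nR im m1 m_unit I_ideal redK.
  have [t [th LE tI]] := minimal_gen L minL.
  have [[_ _ [n Ln]] _] := minL.
  have rt : reduces n I t by split=> //; rewrite -LE Ln.
  have xa : joint_colon I (a :: s) x.
    by apply: (colon_joint I_ideal regular_mod sh rJ); rewrite -JE.
  apply: LK; rewrite LE; apply: (@joint_colon_span R I).
  have tE : unzip2 (zip (a :: s) t) = t by rewrite unzip2_zip // sh th.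
  have sE : unzip1 (zip (a :: s) t) = a :: s by rewrite unzip1_zip // sh th.
  rewrite -tE.
  apply: (@joint_colon_indep R m k pi nR m_unit pi_m k_char0 I h I_ideal regular_mod (maxn r n)).
  + by rewrite size_zip sh th minnn.
  + by rewrite sE; apply: reduces_ge rJ => //; apply: leq_maxl.
  + by rewrite tE; apply: reduces_ge rt => //; apply: leq_maxr.
  + by rewrite sE.
Qed.
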